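(* Let $u,v,y\in\mathbb{C}$ with $|u|,|v|,|y|\le 1$, let $w,x\in\mathbb{C}$ with $\mathrm{Re}(w),\mathrm{Re}(x)\ge 0$, and let $\theta$ be the variable of the Laplace transform in $t$. The joint functional of the process $A(t)$ on the interval $[\tau_{\nu-1},\tau_\nu)$, $$G_2^*(\theta,u,v,w,x,y)=\int_{t\ge 0}e^{-\theta t}\,E\left[u^{A_{\nu-1}}v^{A_\nu}e^{-w\tau_{\nu-1}-x\Delta_\nu}y^{A(t)}\mathbf{1}_{\{\tau_{\nu-1}\le t<\tau_\nu\}}\right]dt,$$ satisfies $$G_2^*(\theta,u,v,w,x,y)=\mathcal{D}_s^{M-1}\left(\Gamma_0+\Gamma B_3\right),$$ where $$\Gamma_0=\frac{\gamma_0(v,x)-\gamma_0(vy,\theta+x)}{\theta+\lambda g(v)-\lambda g(vy)}-\frac{\gamma_0(vs,x)-\gamma_0(vys,\theta+x)}{\theta+\lambda g(vs)-\lambda g(vys)},$$ $$\Gamma=\frac{\gamma(v,x)-\gamma(vy,\theta+x)}{\theta+\lambda g(v)-\lambda g(vy)}-\frac{\gamma(vs,x)-\gamma(vys,\theta+x)}{\theta+\lambda g(vs)-\lambda g(vys)},$$ $$B_3=\frac{\gamma_0(uvys,\theta+w)}{1-\gamma(uvys,\theta+w)}.$$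
   Context: $A(t)$, $t\ge 0$, is a marked (compound) Poisson process with position-independent marking: $A(t)=\sum_{k}a_k\mathbf{1}_{\{t_k\le t\}}$, where $\{t_k\}$ are the points of a Poisson process on $\mathbb{R}_+$ of intensity $\lambda>0$ and the marks $a_k$ are i.i.d. random variables valued in $\{0,1,2,\dots\}$, independent of $\{t_k\}$, with common probability generating function $g(z)=E[z^{a_1}]$, $|z|\le 1$. The process is observed at a delayed renewal process $\{\tau_n:n=0,1,2,\dots\}$ in $\mathbb{R}_+$, independent of the filtration to which $A(t)$ is adapted. Put $\tau_{-1}=0$ and $\Delta_n=\tau_n-\tau_{n-1}$ for $n\ge 0$; $\Delta_1,\Delta_2,\dots$ have a common distribution, while $\Delta_0=\tau_0$ may have a different one. Put $A_n=A(\tau_n)$ for $n\ge 0$, $A_{-1}=0$, and $X_n=A_n-A_{n-1}$. For $|z|\le 1$, $\mathrm{Re}(\theta)\ge 0$, $$\gamma_0(z,\theta)=E\left[z^{X_0}e^{-\theta\Delta_0}\right],\qquad \gamma(z,\theta)=E\left[z^{X_1}e^{-\theta\Delta_1}\right].$$ For a fixed positive integer $M$ (the threshold), the exit index is $\nu=\inf\{n=0,1,2,\dots:A_n>M\}$, and $\tau_\nu$ is the first observed crossing time. For a complex-valued function $\varphi(s)$ analytic at $0$, $\mathcal{D}_s^k\{\varphi(s)\}=\lim_{s\to 0}\frac{1}{k!}\frac{\partial^k}{\partial s^k}\left[\frac{1}{1-s}\varphi(s)\right]$ for $k\ge 0$, and $\mathcal{D}_s^k\{\varphi(s)\}=0$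 for $k<0$.
   Formalization: With ν = inf{n : A_n > M} the formula with D^{M-1} is off by one; proved instead: D^M for A_n > M, and D^{M-1} for A_n ≥ M. Also assumed: Re(θ) > 0 and θ + λg(v) − λg(vy) ≠ 0, so that the integral and the fractions are defined. *)

(* Defs.v *)
From HB Require Import structures.
From mathcomp Require Import all_boot all_order all_algebra.
From mathcomp Require Import all_classical all_reals all_analysis.
From mathcomp Require Import complex.

Set Implicit Arguments.
Unset Strict Implicit.
Unset Printing Implicit Defensive.

Import Order.TTheory GRing.Theory Num.Theory.
Import numFieldNormedType.Exports.

Local Open Scope classical_set_scope.
Local Open Scope ring_scope.
Local Open Scope complex_scope.

Section complex_analysis.
Context {R : realType}.

Definition cexp (z : R[i]) : R[i] :=
  (expR (complex.Re z))%:C * (cos (complex.Im z) +i* sin (complex.Im z)).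

Definition Cintegral d (T : measurableType d) (mu : {measure set T -> \bar R})
    (D : set T) (f : T -> R[i]) : R[i] :=
  (\int[mu]_(x in D) complex.Re (f x))%R +i* (\int[mu]_(x in D) complex.Im (f x))%R.

Definition Cexpectation d (T : measurableType d) (P : probability T R)
    (Z : T -> R[i]) : R[i] := Cintegral P setT Z.

End complex_analysis.

(* On power series, [Dop k] sums the coefficients of s^0, ..., s^k; in
   particular it maps s^j to 1 if j <= k and to 0 otherwise.  It is used with
   C := R[i]; abstracting C gives access to the norm topology. *)
Definition Dop (C : numFieldType) (k : int) (phi : C -> C) : C :=
  match k with
  | Posz n =>
      lim ((n`!%:R)^-1 * derive1n n (fun z : C => (1 - z)^-1 * phi z) s
           @[s --> (0 : C)^'])
  | Negz _ => 0
  end.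

Section independence.
Context {R : realType} {d} {T : measurableType d} (P : probability T R).

Definition mutually_independent d' (U : measurableType d')
    (X : nat -> T -> U) : Prop :=
  forall (J : seq nat) (B : nat -> set U),
    uniq J -> (forall i, measurable (B i)) ->
    P (\bigcap_(i in [set` J]) X i @^-1` B i) =
    (\prod_(i <- J) P (X i @^-1` B i))%E.

Definition same_law d' (U : measurableType d') (X Y : T -> U) : Prop :=
  forall B : set U, measurable B -> P (X @^-1` B) = P (Y @^-1` B).

Definition sigma_of (I : Type) (D : set I) d' (U : measurableType d')
    (X : I -> T -> U) : set (set T) :=
  <<s \bigcup_(i in D) preimage_set_system setT (X i) measurable >>.

Definition independent_sigma (F G : set (set T)) : Prop :=
  forall A B, F A -> G B -> P (A `&` B) = (P A * P B)%E.

End independence.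

Section marked_poisson.
Context {R : realType} {d} {T : measurableType d} (P : probability T R).

(* The sum is finite because the points are locally finite. *)
Definition marked_sum (t : nat -> T -> R) (a : nat -> T -> nat)
    (s : R) (w : T) : nat :=
  \big[addn/0%N]_(k \in [set k | t k w <= s]) a k w.

Definition npoints (t : nat -> T -> R) (s : R) (w : T) : nat :=
  marked_sum t (fun _ _ => 1%N) s w.

(* The points need not be enumerated in increasing order.
   [poisson_pmf] is meaningful for positive rates only, whence [s < s']. *)
Record poisson_points (lambda : R) (t : nat -> T -> R) : Prop := {
  points_ge0 : forall k w, 0 <= t k w ;
  points_locally_finite : forall s w, finite_set [set k | t k w <= s] ;
  npoints0 : P [set w | npoints t 0 w = 0%N] = 1%E ;
  npoints_poisson : forall (s s' : R) (k : nat), 0 <= s -> s < s' ->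
    P [set w | (npoints t s' w - npoints t s w)%N = k] =
    (poisson_pmf (lambda * (s' - s)) k)%:E ;
  npoints_indep : forall s : nat -> R, s 0%N = 0 ->
    (forall n, s n <= s n.+1) ->
    mutually_independent P
      (fun n w => (npoints t (s n.+1) w - npoints t (s n) w)%N)
}.

Record iid_marking (t : nat -> T -> R) (a : nat -> T -> nat) : Prop := {
  marks_indep : mutually_independent P a ;
  marks_same_law : forall k, same_law P (a k) (a 0%N) ;
  marks_points_indep :
    independent_sigma P (sigma_of setT a) (sigma_of setT t)
}.

Definition mark_pgf (a : nat -> T -> nat) (z : R[i]) : R[i] :=
  Cexpectation P (fun w => z ^+ a 0%N w).

End marked_poisson.

Section observed_process.
Context {R : realType} {d} {T : measurableType d} (P : probability T R).

(* [before tau n] is tau_{n-1}, with the convention tau_{-1} = 0. *)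
Definition before (tau : nat -> T -> R) (n : nat) (w : T) : R :=
  if n is m.+1 then tau m w else 0.

Definition gap (tau : nat -> T -> R) (n : nat) (w : T) : R :=
  tau n w - before tau n w.

Record delayed_renewal (tau : nat -> T -> R) : Prop := {
  gaps_ge0 : forall n w, 0 <= gap tau n w ;
  gaps_indep : mutually_independent P (gap tau) ;
  gaps_same_law : forall n, same_law P (gap tau n.+1) (gap tau 1%N)
}.

Variables (A : R -> T -> nat) (tau : nat -> T -> R).

Definition obs (n : nat) (w : T) : nat := A (tau n w) w.

(* [obs_before n] is A_{n-1}, with the convention A_{-1} = 0. *)
Definition obs_before (n : nat) (w : T) : nat :=
  if n is m.+1 then obs m w else 0%N.

(* No truncation occurs, A being nondecreasing. *)
Definition obs_incr (n : nat) (w : T) : nat := (obs n w - obs_before n w)%N.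

(* gamma_0 is [gamma_at 0] and gamma is [gamma_at 1]. *)
Definition gamma_at (n : nat) (z theta : R[i]) : R[i] :=
  Cexpectation P
    (fun w => z ^+ obs_incr n w * cexp (- theta * (gap tau n w)%:C)).

(* The first n such that A_n satisfies [crossed], [None] standing for the
   infimum of the empty set.  As Dop k maps s^A_{n-1} - s^A_n to the indicator
   of A_{n-1} <= k < A_n, strict crossing (A_n > M) pairs with Dop M, whereas
   reaching the threshold (A_n >= M) pairs with Dop (M - 1). *)
Definition exit_index (crossed : pred nat) (w : T) : option nat :=
  if pselect (exists n, crossed (obs n w)) is left ex
  then Some (ex_minn ex) else None.

(* When the exit index is infinite there is no exit interval, so the indicator
   of the event {tau_{nu-1} <= t < tau_nu} vanishes. *)
Definition exit_functional (crossed : pred nat) (u v wt x y : R[i]) (t : R)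
    (w : T) : R[i] :=
  if exit_index crossed w is Some n then
    u ^+ obs_before n w * v ^+ obs n w
    * cexp (- wt * (before tau n w)%:C - x * (gap tau n w)%:C)
    * y ^+ A t w
    * (before tau n w <= t < tau n w)%R%:R
  else 0.

Definition G2star (crossed : pred nat) (theta u v wt x y : R[i]) : R[i] :=
  Cintegral lebesgue_measure `[0, +oo[
    (fun t : R => cexp (- theta * t%:C)
       * Cexpectation P (exit_functional crossed u v wt x y t)).

End observed_process.

Section closed_form.
Context {R : realType} (lambda : R) (g : R[i] -> R[i]).
Implicit Type gam : R[i] -> R[i] -> R[i].

(* Meaningful when the denominator is nonzero; with v * s in place of v, this
   holds for all s near 0 as soon as theta != 0. *)
Definition Gamma_ratio gam (theta v x y : R[i]) : R[i] :=
  (gam v x - gam (v * y) (theta + x))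
  / (theta + lambda%:C * g v - lambda%:C * g (v * y)).

(* With gam = gamma_0 this is Gamma_0, with gam = gamma it is Gamma. *)
Definition Gamma_of gam (theta v x y s : R[i]) : R[i] :=
  Gamma_ratio gam theta v x y - Gamma_ratio gam theta (v * s) x y.

Definition B3 (gam0 gam : R[i] -> R[i] -> R[i]) (theta u v wt y s : R[i]) : R[i] :=
  gam0 (u * v * y * s) (theta + wt) / (1 - gam (u * v * y * s) (theta + wt)).

End closed_form.

(* Main.v *)
Require Import Defs.
From mathcomp Require Import all_boot all_order all_algebra.
From mathcomp Require Import all_classical all_reals all_analysis.
From mathcomp Require Import measurable_realfun complex ring lra zify.

(** At every time t at most one observation interval [tau_(n-1), tau_n) contains
    t. Let i = A_(n-1) <= j = A_n be the levels of the process at its two ends,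
    and weight the functional of that interval by q(i, j). Integrating over t and
    taking expectations gives a linear form [total q]. Since A is nondecreasing,
    the interval is the exit interval of the level k exactly when i <= k < j, so
    the left-hand side is [total] at the weight 1{i <= k < j} ([G2star_total]).

    The weight z^i - z^j, on the other hand, can be computed. Conditionally on the
    observation times, the increments of the compound Poisson process before the
    interval, from its start to t, and from t to its end are independent with
    generating functions exp (- lambda (1 - g) s) over a time s. This is
    [expectation_increments3] for fixed times: the marks are first integrated out
    given the points, which replaces each mark by its generating function, and
    the Poisson counts are independent. It extends to the observation times
    because these are independent from A ([expectation_random_increments]).
    Integrating in t over the interval leaves a difference of two exponentials
    divided by the denominator of [Gamma_ratio], and the delay before the
    interval factors through the independent gaps ([slice_transform]). Summing
    over n gives Gamma_0 for the first interval and, for the others, Gamma times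
    a geometric series that sums to [B3] ([total_powers]). The series converges
    because the transform of a gap is a strict contraction; the only exception is
    a gap that vanishes almost surely, and then Gamma is 0
    ([gap_transform_dichotomy]).

    The operator [Dop] recovers the indicator from the powers: z^i - z^j divided
    by 1 - z is the run z^i + .. + z^(j-1), whose k-th derivative at 0 is k! if
    i <= k < j and 0 otherwise. The derivatives may be taken under [total],
    because near 0 the runs have Taylor bounds that are uniform in i and j
    ([run_deriv_taylor2], [Dop_taylor_family], [Dop_total]). The strict and the
    weak crossing of M are the cases k = M and k = M - 1. *)

Set Implicit Arguments.
Unset Strict Implicit.
Unset Printing Implicit Defensive.

Import Order.TTheory GRing.Theory Num.Theory.
Import numFieldNormedType.Exports.

Local Open Scope classical_set_scope.
Local Open Scope ring_scope.
Local Open Scope complex_scope.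

Local Notation Re := complex.Re.
Local Notation Im := complex.Im.
Local Notation cmod := Normc.normc.

(** * Iterated derivatives from uniform Taylor bounds *)

Section taylor_family.
Variables (C : numFieldType) (F : nat -> C -> C) (K : nat -> C) (r : C).
Hypothesis r_gt0 : 0 < r.
Hypothesis K_ge0 : forall n, 0 <= K n.
Hypothesis taylorF : forall n z h, `|z| < r -> `|z + h| < r ->
  `|F n (z + h) - F n z - h * F n.+1 z| <= K n * `|h| ^+ 2.

(** A second-order bound on each member of the family forces [F n.+1] to be the
    derivative of [F n]; no convergence of power series enters, and the family
    may be given by integrals. *)
Lemma derive1_taylor_family (f : C -> C) n : (forall z, `|z| < r -> f z = F n z) ->
  forall z, `|z| < r -> derive1 f z = F n.+1 z.
Proof.
move=> fF z zr; apply: cvg_lim; first exact: norm_hausdorff.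
apply/cvgrPdist_le => e e0.
have zr0 : 0 < r - `|z| by rewrite subr_gt0.
have Ke0 : 0 < e / (K n + 1) by rewrite divr_gt0// ltr_wpDl.
near=> h.
have h0 : h != 0 by near: h; exact: nbhs_dnbhs_neq.
have hz : `|z + h| < r.
  rewrite (le_lt_trans (ler_normD _ _))// addrC -ltrBrDr.
  by near: h; exact: dnbhs0_lt.
have he : `|h| <= e / (K n + 1) by near: h; exact: dnbhs0_le.
rewrite (addrC h z) !fF// distrC /GRing.scale/= -(mulKf h0 (F n.+1 z)) -mulrBr.
rewrite normrM normfV ler_pdivrMl ?normr_gt0//.
apply: le_trans (taylorF _ zr hz) _; rewrite expr2 mulrCA ler_wpM2l//.
rewrite mulrC (le_trans (ler_wpM2r (K_ge0 n) he))// mulrAC ler_pdivrMr ?ltr_wpDl//.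
by rewrite ler_wpM2l ?ltW// ltrDl.
Unshelve. all: by end_near. Qed.

Lemma derive1n_taylor_family (f : C -> C) : (forall z, `|z| < r -> f z = F 0 z) ->
  forall n z, `|z| < r -> derive1n n f z = F n z.
Proof.
move=> fF; elim=> [|n IHn] //= z zr.
exact: (@derive1_taylor_family (derive1n n f) n).
Qed.

Lemma Dop_taylor_family (phi : C -> C) n :
  (forall z, `|z| < r -> (1 - z)^-1 * phi z = F 0 z) ->
  Dop (Posz n) phi = (n`!%:R)^-1 * F n 0.
Proof.
move=> phiF /=; apply: cvg_lim; first exact: norm_hausdorff.
apply: cvgMl_tmp; apply/cvgrPdist_le => e e0.
pose D := K n + `|F n.+1 0| + 1.
have D0 : 0 < D by rewrite ltr_wpDl// addr_ge0.
have eD : 0 < e / D by rewrite divr_gt0.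
near=> h.
have hr : `|h| < r by near: h; exact: dnbhs0_lt.
have h1 : `|h| <= 1 by near: h; exact: dnbhs0_le.
have he : `|h| <= e / D by near: h; exact: dnbhs0_le.
rewrite (derive1n_taylor_family phiF)// distrC.
have := @taylorF n 0 h; rewrite normr0 add0r => /(_ r_gt0 hr) H.
rewrite -[X in `|X|](subrK (h * F n.+1 0)) (le_trans (ler_normD _ _))//.
apply: (@le_trans _ _ (`|h| * D)); last first.
  by rewrite (le_trans (ler_wpM2r (ltW D0) he))// divfK// gt_eqF.
rewrite /D !mulrDr mulr1 -[leRHS]addrA; apply: lerD; last by rewrite normrM lerDl.
by rewrite (le_trans H)// expr2 mulrA mulrC ler_wpM2l// ler_piMr.
Unshelve. all: by end_near. Qed.

End taylor_family.
(** * Derivatives of a run of powers *)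

Section geometric_run.
Variable C : numFieldType.
Implicit Types (z h : C) (a b n i j : nat).

(** The n-th derivative of the run z^a + .. + z^(b-1). For j < n the falling
    factorial vanishes, so that the truncated exponent is harmless. *)
Definition run_deriv n a b z : C :=
  \sum_(a <= j < b) (j ^_ n)%:R * z ^+ (j - n).

Lemma run_deriv_telescope a b z : (a <= b)%N ->
  (1 - z) * run_deriv 0 a b z = z ^+ a - z ^+ b.
Proof.
move=> ab; rewrite mulr_sumr -[RHS]opprB -(telescope_sumr (fun j => z ^+ j) ab) -sumrN.
apply: eq_bigr => j _; rewrite ffactn0 subn0 exprS; ring.
Qed.

Lemma run_deriv_at0 n a b : run_deriv n a b 0 = (n`!)%:R * (a <= n < b)%N%:R.
Proof.
have E j : (j ^_ n)%:R * (0 : C) ^+ (j - n) = if j == n then n`!%:R else 0.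
  rewrite expr0n subn_eq0; case: ltngtP => [jn|jn|->].
  - by rewrite ffact_small// mul0r.
  - by rewrite mulr0.
  - by rewrite mulr1 ffactnn.
rewrite /run_deriv (eq_bigr _ (fun j _ => E j)) -big_mkcond/=.
have [/andP[an nb]|nab] := boolP (a <= n < b)%N.
  by rewrite mulr1 -big_filter filter_pred1_uniq ?iota_uniq ?big_seq1// mem_index_iota an.
rewrite mulr0 big1_seq// => j /andP[/eqP->]; rewrite mem_index_iota.
by rewrite (negbTE nab).
Qed.

Lemma bin_le_exp2 j n : ('C(j, n) <= 2 ^ j)%N.
Proof.
elim: j n => [|j IHj] [|n]; rewrite ?bin0 ?bin0n ?expn_gt0//.
by rewrite binS expnS mul2n -addnn leq_add.
Qed.

(** The second-order remainder of [z ^+ i] obeys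
    R_(i+1) = (z + h) R_i + i h^2 z^(i-1). *)
Lemma taylor2_exp (r z h : C) i : 0 < r -> `|z| <= r -> `|z + h| <= r ->
  `|(z + h) ^+ i - z ^+ i - h * (i%:R * z ^+ i.-1)|
    <= (i%:R ^+ 2 * r ^+ i) * r ^- 2 * `|h| ^+ 2.
Proof.
move=> r0 zr zhr; elim: i => [|i IHi].
  by rewrite !expr0 subrr mul0r mulr0 subrr normr0 expr0n !mul0r.
have -> : (z + h) ^+ i.+1 - z ^+ i.+1 - h * (i.+1%:R * z ^+ i.+1.-1)
    = (z + h) * ((z + h) ^+ i - z ^+ i - h * (i%:R * z ^+ i.-1))
      + i%:R * h ^+ 2 * z ^+ i.-1.
  case: i {IHi} => [|i] /=; first by rewrite !expr0 !expr1; ring.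
  by rewrite !exprS -!natr1; ring.
apply: le_trans (ler_normD _ _) _; rewrite !normrM !normrX normr_nat.
have r2 : r ^+ 2 != 0 by rewrite expf_neq0// gt_eqF.
apply: (@le_trans _ _ (r * ((i%:R ^+ 2 * r ^+ i) * r ^- 2 * `|h| ^+ 2)
    + i%:R * `|h| ^+ 2 * (r ^+ i.+1 * r ^- 2))).
  apply: lerD; first by rewrite ler_pM.
  rewrite -!mulrA mulrCA [leRHS]mulrCA ler_wpM2l ?exprn_ge0//.
  case: i {IHi} => [|i] /=; first by rewrite !mul0r.
  rewrite (_ : r ^+ i.+2 = r ^+ i * r ^+ 2) ?mulfK//; last by rewrite -exprD addn2.
  by rewrite !ler_wpM2l// lerXn2r ?nnegrE// ltW.
have -> : r * (i%:R ^+ 2 * r ^+ i / r ^+ 2 * `|h| ^+ 2)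
    + i%:R * `|h| ^+ 2 * (r ^+ i.+1 / r ^+ 2)
    = (i%:R ^+ 2 + i%:R) * (r ^+ i.+1 * r ^- 2 * `|h| ^+ 2)
  by rewrite (exprS r i); ring.
have Hi : i%:R ^+ 2 + i%:R <= i.+1%:R ^+ 2 :> C.
  by rewrite -natrX -natrD -natrX ler_nat; nia.
apply: le_trans (ler_wpM2r _ Hi) _; last by rewrite !mulrA.
by rewrite !mulr_ge0 ?invr_ge0 ?exprn_ge0// ltW.
Qed.

Let rho : C := 16%:R^-1.

Let rho_gt0 : 0 < rho. Proof. by rewrite invr_gt0. Qed.

(** On the disc of radius 1/16 the terms of every derivative of the run are
    dominated by a geometric sequence of ratio 1/2: a falling factorial costs
    2^j, and the squared exponent of the second-order remainder 4^j. *)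
Let ffact_geo n j : (j ^_ n)%:R * (4%:R ^+ j * rho ^+ (j - n))
  <= n`!%:R * 16%:R ^+ n * 2%:R ^- j :> C.
Proof.
have [jn|nj] := ltnP j n.
  by rewrite ffact_small// mul0r !mulr_ge0 ?invr_ge0 ?exprn_ge0.
have -> : rho ^+ (j - n) = 16%:R ^+ n / 16%:R ^+ j.
  by rewrite /rho exprVn -[in RHS](subnK nj) exprD invfM mulrCA mulfV ?mulr1// expf_neq0// pnatr_eq0.
have -> : (16%:R : C) ^+ j = 2%:R ^+ j * 2%:R ^+ j * 4%:R ^+ j by rewrite -!exprMn -!natrM.
have -> : (j ^_ n)%:R * (4%:R ^+ j * (16%:R ^+ n / (2%:R ^+ j * 2%:R ^+ j * 4%:R ^+ j)))
    = (j ^_ n)%:R * 2%:R ^- j * 16%:R ^+ n * 2%:R ^- j :> C.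
  by field; rewrite !expf_neq0 ?pnatr_eq0.
rewrite ler_wpM2r ?invr_ge0 ?exprn_ge0// ler_wpM2r ?exprn_ge0//.
rewrite ler_pdivrMr ?exprn_gt0// -natrX -natrM ler_nat -bin_ffact mulnC leq_mul2l.
by rewrite bin_le_exp2 orbT.
Qed.

Let geo_half a b : \sum_(a <= j < b) 2%:R ^- j <= 2%:R :> C.
Proof.
have H : \sum_(0 <= j < b) (2%:R ^- j : C) = 2%:R - 2%:R * 2%:R ^- b.
  elim: b => [|b IHb]; first by rewrite big_geq// expr0 invr1 mulr1 subrr.
  rewrite big_nat_recr//= IHb exprS invfM; field.
  by rewrite expf_neq0 ?pnatr_eq0.
apply: (@le_trans _ _ (\sum_(0 <= j < b) (2%:R ^- j : C))); last first.
  by rewrite H gerBl mulr_ge0 ?invr_ge0 ?exprn_ge0.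
have [ab|ba] := leqP a b; last first.
  by rewrite big_geq 1?ltnW// sumr_ge0// => j _; rewrite invr_ge0 exprn_ge0.
by rewrite [leRHS](big_cat_nat (leq0n a) ab)/= lerDr sumr_ge0.
Qed.

(** The bound is uniform in the ends of the run: this is what lets the
    derivatives pass under an integral over random levels. *)
Lemma run_deriv_le n a b z : `|z| < 16%:R^-1 ->
  `|run_deriv n a b z| <= n`!%:R * 16%:R ^+ n * 2%:R.
Proof.
move=> /ltW zr; apply: le_trans (ler_norm_sum _ _ _) _.
have D0 : 0 <= n`!%:R * 16%:R ^+ n :> C by rewrite mulr_ge0 ?exprn_ge0.
apply: le_trans (ler_wpM2l D0 (geo_half a b)).
rewrite mulr_sumr ler_sum// => j _; apply: le_trans (ffact_geo n j).
rewrite normrM normr_nat ler_wpM2l// normrX.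
apply: (@le_trans _ _ (rho ^+ (j - n))); first by rewrite lerXn2r ?nnegrE// ltW.
by apply: ler_peMl; [rewrite exprn_ge0// ltW | rewrite exprn_ege1// ler1n].
Qed.

Lemma run_deriv_taylor2 n a b z h : `|z| < 16%:R^-1 -> `|z + h| < 16%:R^-1 ->
  `|run_deriv n a b (z + h) - run_deriv n a b z - h * run_deriv n.+1 a b z|
    <= n`!%:R * 16%:R ^+ n * 2%:R * 16%:R ^+ 2 * `|h| ^+ 2.
Proof.
move=> /ltW zr /ltW zhr; rewrite mulr_sumr -sumrB -sumrB.
apply: le_trans (ler_norm_sum _ _ _) _.
have D0 : 0 <= n`!%:R * 16%:R ^+ n :> C by rewrite mulr_ge0 ?exprn_ge0.
have D1 : 0 <= 16%:R ^+ 2 * `|h| ^+ 2 by rewrite mulr_ge0 ?exprn_ge0.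
rewrite -mulrA; apply: le_trans (ler_wpM2r D1 (ler_wpM2l D0 (geo_half a b))).
rewrite mulr_sumr mulr_suml ler_sum// => j _.
apply: le_trans (ler_wpM2r D1 (ffact_geo n j)).
have -> : (j ^_ n)%:R * (z + h) ^+ (j - n) - (j ^_ n)%:R * z ^+ (j - n)
    - h * ((j ^_ n.+1)%:R * z ^+ (j - n.+1))
  = (j ^_ n)%:R * ((z + h) ^+ (j - n) - z ^+ (j - n)
       - h * ((j - n)%:R * z ^+ (j - n).-1)).
  by rewrite ffactnSr natrM subnS; ring.
rewrite normrM normr_nat -mulrA ler_wpM2l//.
apply: le_trans (taylor2_exp (j - n) rho_gt0 zr zhr) _.
have -> : rho ^- 2 = 16%:R ^+ 2 by rewrite /rho exprVn invrK.
rewrite -mulrA ler_wpM2r// ler_wpM2r ?exprn_ge0 ?(ltW rho_gt0)//.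
rewrite -!natrX ler_nat.
have : (j - n < 2 ^ (j - n))%N by exact: ltn_expl.
have : (2 ^ (j - n) <= 2 ^ j)%N by rewrite leq_exp2l// leq_subr.
by rewrite -[4%N]/(2 ^ 2)%N -expnM mulnC expnM => h1 h2; rewrite leq_sqr (leq_trans (ltnW h2)).
Qed.

End geometric_run.
(** * Complex modulus and exponential *)

Section modulus.
Context {R : realType}.
Implicit Types z w : R[i].

Lemma normcE_cmod z : `|z| = (cmod z)%:C. Proof. by case: z. Qed.

Lemma cmod_ge0 z : 0 <= cmod z. Proof. by case: z => a b; exact: sqrtr_ge0. Qed.

Lemma le_cmodP z (k : R) : (`|z| <= k%:C) = (cmod z <= k).
Proof. by rewrite normcE_cmod lecR. Qed.

Lemma cmodD z w : cmod (z + w) <= cmod z + cmod w. Proof. exact: le_normcD. Qed.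

Lemma cmodM z w : cmod (z * w) = cmod z * cmod w. Proof. exact: Normc.normcM. Qed.

Lemma cmodN z : cmod (- z) = cmod z. Proof. exact: normcN. Qed.

Lemma cmod1 : cmod (1 : R[i]) = 1. Proof. exact: Normc.normc1. Qed.

Lemma cmod0 : cmod (0 : R[i]) = 0. Proof. exact: Normc.normc0. Qed.

Lemma cmodX z n : cmod (z ^+ n) = cmod z ^+ n.
Proof. by elim: n => [|n IHn]; rewrite ?expr0 ?cmod1// !exprS cmodM IHn. Qed.

Lemma cmodR (k : R) : cmod k%:C = `|k|.
Proof. by rewrite /= expr0n addr0 sqrtr_sqr. Qed.

Lemma cmod_Re z : `|Re z| <= cmod z.
Proof. by rewrite -lecR -normcE_cmod normc_ge_Re. Qed.

Lemma cmod_Im z : `|Im z| <= cmod z.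
Proof.
case: z => a b /=; rewrite -(sqrtr_sqr b) ler_sqrt ?addr_ge0 ?sqr_ge0//.
by rewrite lerDr sqr_ge0.
Qed.

Lemma cmod_le z : cmod z <= `|Re z| + `|Im z|.
Proof.
case: z => a b /=; rewrite -[leRHS]ger0_norm ?addr_ge0// -sqrtr_sqr ler_sqrt ?sqr_ge0//.
rewrite sqrrD !real_normK ?num_real// [leRHS]addrAC lerDl.
by rewrite mulrn_wge0 ?mulr_ge0.
Qed.

Lemma cmodX_le1 z n : cmod z <= 1 -> cmod (z ^+ n) <= 1.
Proof. by move=> z1; rewrite cmodX exprn_ile1 ?cmod_ge0. Qed.

Lemma cmodM_le1 z w : cmod z <= 1 -> cmod w <= 1 -> cmod (z * w) <= 1.
Proof. by move=> z1 w1; rewrite cmodM mulr_ile1 ?cmod_ge0. Qed.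

Lemma complex_ext z w : Re z = Re w -> Im z = Im w -> z = w.
Proof. by case: z w => [a b] [c e] /= -> ->. Qed.

Lemma cReM z w : Re (z * w) = Re z * Re w - Im z * Im w.
Proof. by case: z w => [a b] [c e]. Qed.

Lemma cImM z w : Im (z * w) = Re z * Im w + Im z * Re w.
Proof. by case: z w => [a b] [c e]. Qed.

Lemma cReD z w : Re (z + w) = Re z + Re w. Proof. by case: z w => [a b] [c e]. Qed.

Lemma cImD z w : Im (z + w) = Im z + Im w. Proof. by case: z w => [a b] [c e]. Qed.

Lemma cReN z : Re (- z) = - Re z. Proof. by case: z. Qed.

Lemma cImN z : Im (- z) = - Im z. Proof. by case: z. Qed.

Lemma Re_cexp z : Re (cexp z) = expR (Re z) * cos (Im z).
Proof. by rewrite /cexp cReM /= mul0r subr0. Qed.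

Lemma Im_cexp z : Im (cexp z) = expR (Re z) * sin (Im z).
Proof. by rewrite /cexp cImM /= mul0r addr0. Qed.

Lemma cexpD z w : cexp (z + w) = cexp z * cexp w.
Proof.
apply: complex_ext.
  by rewrite (cReM (cexp z)) !Re_cexp !Im_cexp cReD cImD expRD cosD; ring.
by rewrite (cImM (cexp z)) !Re_cexp !Im_cexp cReD cImD expRD sinD; ring.
Qed.

Lemma cexp0 : cexp (0 : R[i]) = 1.
Proof. by apply: complex_ext; rewrite ?Re_cexp ?Im_cexp /= expR0 ?cos0 ?sin0 ?mulr1 ?mulr0. Qed.

Lemma cexpN z : cexp (- z) * cexp z = 1.
Proof. by rewrite -cexpD addNr cexp0. Qed.

Lemma cmod_cexp z : cmod (cexp z) = expR (Re z).
Proof.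
rewrite /cexp cmodM cmodR ger0_norm ?expR_ge0//=.
by rewrite cos2Dsin2 sqrtr1 mulr1.
Qed.

Lemma cmod_cexp_le1 z : Re z <= 0 -> cmod (cexp z) <= 1.
Proof. by rewrite cmod_cexp -(expR0 R) ler_expR. Qed.

Lemma real_complexM (k l : R) : (k * l)%:C = k%:C * l%:C :> R[i].
Proof. exact: rmorphM. Qed.

Lemma real_complexB (k l : R) : (k - l)%:C = k%:C - l%:C :> R[i].
Proof. exact: rmorphB. Qed.

Lemma cReMr z (k : R) : Re (z * k%:C) = Re z * k.
Proof. by rewrite cReM /= mulr0 subr0. Qed.

Lemma cReMl z (k : R) : Re (k%:C * z) = k * Re z.
Proof. by rewrite mulrC cReMr mulrC. Qed.

Lemma cImMr z (k : R) : Im (z * k%:C) = Im z * k.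
Proof. by rewrite cImM /= mulr0 add0r. Qed.

End modulus.

(** * Measurable complex functions *)

Section complex_measurability.
Context {R : realType} {d} {T : measurableType d}.
Implicit Types f g : T -> R[i].

Definition cmeasurable f :=
  measurable_fun setT (fun w => Re (f w)) /\ measurable_fun setT (fun w => Im (f w)).

Lemma cmeasurable_ext f g : f =1 g -> cmeasurable f -> cmeasurable g.
Proof. by move=> /funext->. Qed.

Lemma cmeasurable_cst (c : R[i]) : cmeasurable (fun=> c).
Proof. by split; exact: measurable_cst. Qed.

Lemma cmeasurableD f g : cmeasurable f -> cmeasurable g -> cmeasurable (fun w => f w + g w).
Proof.
move=> [f1 f2] [g1 g2]; split.
  by under eq_fun do rewrite cReD; exact: measurable_funD.
by under eq_fun do rewrite cImD; exact: measurable_funD.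
Qed.

Lemma cmeasurableM f g : cmeasurable f -> cmeasurable g -> cmeasurable (fun w => f w * g w).
Proof.
move=> [f1 f2] [g1 g2]; split.
  by under eq_fun do rewrite cReM; apply: measurable_funB; exact: measurable_funM.
by under eq_fun do rewrite cImM; apply: measurable_funD; exact: measurable_funM.
Qed.

Lemma cmeasurableN f : cmeasurable f -> cmeasurable (fun w => - f w).
Proof.
move=> mf; apply: (cmeasurable_ext (f := fun w => -1 * f w)) => [w|].
  by rewrite mulN1r.
by apply: cmeasurableM => //; exact: cmeasurable_cst.
Qed.

Lemma cmeasurableB f g : cmeasurable f -> cmeasurable g -> cmeasurable (fun w => f w - g w).
Proof. by move=> mf mg; apply: cmeasurableD => //; exact: cmeasurableN. Qed.

Lemma cmeasurable_sum (I : Type) (s : seq I) (p : pred I) (F : I -> T -> R[i]) :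
  (forall i, cmeasurable (F i)) -> cmeasurable (fun w => \sum_(i <- s | p i) F i w).
Proof.
move=> mF; elim: s => [|i s IHs].
  by under eq_fun do rewrite big_nil; exact: cmeasurable_cst.
under eq_fun do rewrite big_cons.
by case: (p i) => //; exact: cmeasurableD.
Qed.

Lemma cmeasurable_prod (I : Type) (s : seq I) (F : I -> T -> R[i]) :
  (forall i, cmeasurable (F i)) -> cmeasurable (fun w => \prod_(i <- s) F i w).
Proof.
move=> mF; elim: s => [|i s IHs].
  by under eq_fun do rewrite big_nil; exact: cmeasurable_cst.
by under eq_fun do rewrite big_cons; exact: cmeasurableM.
Qed.

Lemma cmeasurable_real (r : T -> R) : measurable_fun setT r -> cmeasurable (fun w => (r w)%:C).
Proof. by move=> mr; split=> //; exact: measurable_cst. Qed.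

Lemma cmeasurable_nat (N : T -> nat) (h : nat -> R[i]) :
  measurable_fun setT N -> cmeasurable (fun w => h (N w)).
Proof.
by move=> mN; split; [apply: (measurableT_comp (f := fun n => Re (h n)))
  | apply: (measurableT_comp (f := fun n => Im (h n)))].
Qed.

Lemma cmeasurable_bool (b : T -> bool) : measurable_fun setT b ->
  cmeasurable (fun w => (b w)%:R).
Proof.
move=> mb; apply: (cmeasurable_ext (f := fun w => (if b w then 1 else 0 : R)%:C)) => [w|].
  by case: (b w).
by apply: cmeasurable_real; apply: measurable_fun_ifT => //; exact: measurable_cst.
Qed.

Lemma cmeasurable_cexp f : cmeasurable f -> cmeasurable (fun w => cexp (f w)).
Proof.
move=> [mf1 mf2]; split.
  under eq_fun do rewrite Re_cexp; apply: measurable_funM.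
    by apply: (measurableT_comp (f := expR)) => //; exact: measurable_expR.
  apply: (measurableT_comp (f := cos)) => //.
  by apply: continuous_measurable_fun; exact: continuous_cos.
under eq_fun do rewrite Im_cexp; apply: measurable_funM.
  by apply: (measurableT_comp (f := expR)) => //; exact: measurable_expR.
apply: (measurableT_comp (f := sin)) => //.
by apply: continuous_measurable_fun; exact: continuous_sin.
Qed.

End complex_measurability.

Lemma cmeasurable_comp (R : realType) d d' (T : measurableType d) (U : measurableType d')
    (f : U -> R[i]) (X : T -> U) :
  measurable_fun setT X -> cmeasurable f -> cmeasurable (fun w => f (X w)).
Proof.
by move=> mX [mf1 mf2]; split;
  [exact: (measurableT_comp mf1 mX) | exact: (measurableT_comp mf2 mX)].
Qed.

(** * Integrals of complex functions *)

Section complex_integral.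
Context {R : realType} {d} {T : measurableType d} (mu : {measure set T -> \bar R}).
Implicit Types (f g : T -> R[i]) (h : T -> R).

Local Notation cint f := (Cintegral mu setT f).

Definition cintegrable f :=
  mu.-integrable setT (EFin \o (fun w => Re (f w))) /\
  mu.-integrable setT (EFin \o (fun w => Im (f w))).

Lemma eq_cint f g : f =1 g -> cint f = cint g.
Proof. by move=> /funext->. Qed.

Lemma cint_mkcond (D : set T) f g : (forall w, D w -> f w = g w) ->
  (forall w, ~ D w -> g w = 0) -> Cintegral mu D f = cint g.
Proof.
move=> fg g0; apply: complex_ext; rewrite /= Rintegral_mkcond; apply: eq_Rintegral => w _;
  by rewrite patchE; case: ifPn => [/set_mem Dw|/negP nD];
    [rewrite fg | rewrite g0// => Dw; apply: nD; exact: mem_set].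
Qed.

Lemma cintegrable_ext f g : f =1 g -> cintegrable f -> cintegrable g.
Proof. by move=> /funext->. Qed.

Lemma cintegrable_dominated f h : cmeasurable f -> mu.-integrable setT (EFin \o h) ->
  (forall w, cmod (f w) <= h w) -> cintegrable f.
Proof.
move=> [mf1 mf2] hi fh; split.
  apply: le_integrable hi => //; first exact/measurable_EFinP.
  by move=> w _ /=; rewrite lee_fin (le_trans (cmod_Re _))// (le_trans (fh w))// ler_norm.
apply: le_integrable hi => //; first exact/measurable_EFinP.
by move=> w _ /=; rewrite lee_fin (le_trans (cmod_Im _))// (le_trans (fh w))// ler_norm.
Qed.

Lemma cintegrableD f g : cintegrable f -> cintegrable g -> cintegrable (fun w => f w + g w).
Proof.
move=> [f1 f2] [g1 g2]; split.
  by apply: eq_integrable (integrableD _ f1 g1) => // w _ /=; rewrite cReD EFinD.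
by apply: eq_integrable (integrableD _ f2 g2) => // w _ /=; rewrite cImD EFinD.
Qed.

Lemma cintegrableZ (c : R[i]) f : cintegrable f -> cintegrable (fun w => c * f w).
Proof.
move=> [f1 f2]; split.
  apply: eq_integrable (integrableB _ (integrableZl _ (Re c) f1) (integrableZl _ (Im c) f2)) => //.
  by move=> w _ /=; rewrite cReM EFinB !EFinM.
apply: eq_integrable (integrableD _ (integrableZl _ (Re c) f2) (integrableZl _ (Im c) f1)) => //.
by move=> w _ /=; rewrite cImM EFinD !EFinM.
Qed.

Lemma cintegrableB f g : cintegrable f -> cintegrable g -> cintegrable (fun w => f w - g w).
Proof.
move=> fi gi; apply: (cintegrable_ext (f := fun w => f w + -1 * g w)) => [w|].
  by rewrite mulN1r.
by apply: cintegrableD => //; exact: cintegrableZ.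
Qed.

Lemma cintegrable0 : cintegrable (fun=> 0).
Proof. by split; exact: integrable0. Qed.

Lemma cintegrable_sum (I : Type) (s : seq I) (F : I -> T -> R[i]) :
  (forall i, cintegrable (F i)) -> cintegrable (fun w => \sum_(i <- s) F i w).
Proof.
move=> Fi; elim: s => [|i s IHs].
  by under eq_fun do rewrite big_nil; exact: cintegrable0.
by under eq_fun do rewrite big_cons; exact: cintegrableD.
Qed.

Lemma cintD f g : cintegrable f -> cintegrable g ->
  cint (fun w => f w + g w) = cint f + cint g.
Proof.
move=> [f1 f2] [g1 g2]; rewrite /Cintegral; apply: complex_ext => /=.
  by under eq_Rintegral do rewrite cReD; rewrite RintegralD.
by under eq_Rintegral do rewrite cImD; rewrite RintegralD.
Qed.

Lemma cintZ (c : R[i]) f : cintegrable f -> cint (fun w => c * f w) = c * cint f.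
Proof.
move=> [f1 f2]; apply: complex_ext; rewrite ?cReM ?cImM /=.
  under eq_Rintegral do rewrite cReM.
  rewrite RintegralB// ?RintegralZl//.
    by apply: eq_integrable (integrableZl _ (Re c) f1) => // w _ /=; rewrite EFinM.
  by apply: eq_integrable (integrableZl _ (Im c) f2) => // w _ /=; rewrite EFinM.
under eq_Rintegral do rewrite cImM.
rewrite RintegralD// ?RintegralZl//.
  by apply: eq_integrable (integrableZl _ (Re c) f2) => // w _ /=; rewrite EFinM.
by apply: eq_integrable (integrableZl _ (Im c) f1) => // w _ /=; rewrite EFinM.
Qed.

Lemma cintB f g : cintegrable f -> cintegrable g ->
  cint (fun w => f w - g w) = cint f - cint g.
Proof.
move=> fi gi; rewrite -mulN1r -cintZ// -cintD//; last exact: cintegrableZ.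
by apply: eq_cint => w; rewrite mulN1r.
Qed.

Lemma cint0 : cint (fun=> 0) = 0.
Proof. by rewrite /Cintegral Rintegral_cst// mul0r. Qed.

Lemma cint_sum (I : Type) (s : seq I) (F : I -> T -> R[i]) :
  (forall i, cintegrable (F i)) ->
  cint (fun w => \sum_(i <- s) F i w) = \sum_(i <- s) cint (F i).
Proof.
move=> Fi; elim: s => [|i s IHs].
  by rewrite big_nil -[RHS]cint0; apply: eq_cint => w; rewrite big_nil.
rewrite big_cons -IHs -cintD//; last exact: cintegrable_sum.
by apply: eq_cint => w; rewrite big_cons.
Qed.

(** Rotating the integral onto the positive real axis, by multiplying by its
    own conjugate, turns its modulus into the integral of a real part. *)
Lemma cmod_cint_le f h : cintegrable f -> mu.-integrable setT (EFin \o h) ->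
  (forall w, cmod (f w) <= h w) -> cmod (cint f) <= \int[mu]_w h w.
Proof.
move=> fi hi fh; set I := cint f.
have h0 : 0 <= \int[mu]_w h w.
  by apply: Rintegral_ge0 => w _; rewrite (le_trans (cmod_ge0 _) (fh w)).
have [I0|Ipos] := leP (cmod I) 0; first exact: le_trans I0 h0.
have EI : cmod I ^+ 2 = \int[mu]_w Re (I^* * f w).
  rewrite -[RHS]/(Re (cint (fun w => I^* * f w))) cintZ// -/I.
  case: I {Ipos} => a b; rewrite /= sqr_sqrtr ?addr_ge0 ?sqr_ge0//.
  by rewrite !expr2 mulNr opprK.
have cJ : cmod (I^*) = cmod I by case: (I) => a b; rewrite /= sqrrN.
rewrite -(ler_pM2l Ipos) -expr2 EI -RintegralZl//; apply: le_Rintegral => //.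
- by have [] := cintegrableZ (I^*) fi.
- by apply: eq_integrable (integrableZl _ (cmod I) hi) => // w _ /=; rewrite EFinM.
- move=> w _; apply: le_trans (ler_norm _) _; apply: le_trans (cmod_Re _) _.
  by rewrite cmodM cJ ler_wpM2l// cmod_ge0.
Qed.

(** Convergence is taken componentwise, in the topology of the real numbers. *)
Definition ccvg (u : nat -> R[i]) (l : R[i]) :=
  ((fun n => Re (u n)) @ \oo --> Re l) /\ ((fun n => Im (u n)) @ \oo --> Im l).

Lemma ccvg_unique u l l' : ccvg u l -> ccvg u l' -> l = l'.
Proof.
move=> [a b] [a' b']; apply: complex_ext.
  by rewrite -(cvg_lim _ a) ?(cvg_lim _ a').
by rewrite -(cvg_lim _ b) ?(cvg_lim _ b').
Qed.

Lemma ccvg_ext u v l : u =1 v -> ccvg u l -> ccvg v l.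
Proof. by move=> /funext->. Qed.

Lemma ccvg_cst (l : R[i]) : ccvg (fun=> l) l.
Proof. by split; exact: cvg_cst. Qed.

Lemma ccvg_shift u l : ccvg u l -> ccvg (fun n => u n.+1) l.
Proof.
move=> [a b]; split.
  by rewrite (cvg_shiftS (fun n => Re (u n))).
by rewrite (cvg_shiftS (fun n => Im (u n))).
Qed.

Lemma ccvgZ (c : R[i]) u l : ccvg u l -> ccvg (fun n => c * u n) (c * l).
Proof.
move=> [a b]; split.
  by under eq_fun do rewrite cReM; rewrite cReM; apply: cvgB; apply: cvgMl_tmp.
by under eq_fun do rewrite cImM; rewrite cImM; apply: cvgD; apply: cvgMl_tmp.
Qed.

Lemma ccvg_eventually u l N : (forall n, (N <= n)%N -> u n = l) -> ccvg u l.
Proof.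
move=> uN; split; apply: cvg_near_cst; near=> n; rewrite uN//; near: n;
  exact: nbhs_infty_ge.
Unshelve. all: by end_near. Qed.

Lemma ccvg_squeeze u l (e : nat -> R) : (forall n, cmod (u n - l) <= e n) ->
  e @ \oo --> 0 -> ccvg u l.
Proof.
move=> ue e0; split; apply/cvgrPdist_le => k k0; near=> n;
  (apply: (@le_trans _ _ (e n));
   [|apply: le_trans (ler_norm _) _; near: n;
     have /cvgrPdist_le/(_ _ k0) := e0; apply: filterS => n; by rewrite sub0r normrN]).
  by rewrite distrC -cReN -cReD (le_trans (cmod_Re _)).
by rewrite distrC -cImN -cImD (le_trans (cmod_Im _)).
Unshelve. all: by end_near. Qed.

Lemma cdominated_convergence (F : nat -> T -> R[i]) f h :
  (forall n, cmeasurable (F n)) -> cmeasurable f ->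
  mu.-integrable setT (EFin \o h) -> (forall n w, cmod (F n w) <= h w) ->
  (forall w, ccvg (F ^~ w) (f w)) ->
  ccvg (fun n => cint (F n)) (cint f).
Proof.
move=> mF mf hi Fh Ff.
have DCT (p : R[i] -> R) : (forall n, measurable_fun setT (fun w => p (F n w))) ->
    measurable_fun setT (fun w => p (f w)) -> (forall z, `|p z| <= cmod z) ->
    (forall w, (fun n => p (F n w)) @ \oo --> p (f w)) ->
    (fun n => \int[mu]_w p (F n w)) @ \oo --> \int[mu]_w p (f w).
  move=> mpF mpf pc pcvg.
  have [|||||i1 _ i2] := @dominated_convergence _ _ _ mu setT measurableT
    (fun n w => (p (F n w))%:E) (fun w => (p (f w))%:E) (EFin \o h).
  - by move=> n; exact/measurable_EFinP.
  - exact/measurable_EFinP.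
  - by apply: aeW => w _; apply: cvg_EFin; [exact: nearW|exact: pcvg].
  - exact: hi.
  - by apply: aeW => w n _ /=; rewrite lee_fin (le_trans (pc _)).
  by apply: fine_cvg; rewrite fineK; [exact: i2|exact: integrable_fin_num].
split.
- apply: (DCT (fun z => Re z)) => [n|||w]; [by case: (mF n)|by case: mf| |by case: (Ff w)].
  by move=> z; exact: cmod_Re.
- apply: (DCT (fun z => Im z)) => [n|||w]; [by case: (mF n)|by case: mf| |by case: (Ff w)].
  by move=> z; exact: cmod_Im.
Qed.

Lemma ae_eq_cint f g : cmeasurable f -> cmeasurable g ->
  {ae mu, forall w, f w = g w} -> cint f = cint g.
Proof.
move=> [f1 f2] [g1 g2] fg; apply: complex_ext => /=; congr fine;
  apply: ae_eq_integral => //; try (by apply/measurable_EFinP).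
  by apply: filterS fg => w -> .
by apply: filterS fg => w -> .
Qed.

End complex_integral.

(** * Image measures and Fubini *)

Section change_of_variables.
Context {R : realType} {d d'} {T : measurableType d} {U : measurableType d'}.
Variable P : probability T R.

Definition rv_of (X : T -> U) (mX : measurable_fun setT X) : {RV P >-> U} :=
  MeasurableFun.Pack (MeasurableFun.Class (isMeasurableFun.Build _ _ _ _ X mX)).

Lemma cintegrable_bounded (f : T -> R[i]) (k : R) :
  cmeasurable f -> (forall w, cmod (f w) <= k) -> cintegrable P f.
Proof.
move=> mf fk; apply: (cintegrable_dominated (h := fun=> k)) => //.
exact: finite_measure_integrable_cst.
Qed.

Lemma Cexpectation_cst (c : R[i]) : Cexpectation P (fun=> c) = c.
Proof.
rewrite /Cexpectation /Cintegral !Rintegral_cst// [X in fine X](probability_setT P).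
by rewrite !mulr1; case: c.
Qed.

Lemma cmod_Cexpectation_le (f : T -> R[i]) (k : R) :
  cmeasurable f -> (forall w, cmod (f w) <= k) -> cmod (Cexpectation P f) <= k.
Proof.
move=> mf fk; have ki := finite_measure_integrable_cst P k measurableT.
apply: le_trans (cmod_cint_le (cintegrable_bounded mf fk) ki fk) _.
by rewrite Rintegral_cst// [X in fine X](probability_setT P) mulr1.
Qed.

Lemma cint_distribution (X : T -> U) (mX : measurable_fun setT X) (f : U -> R[i]) (k : R) :
  cmeasurable f -> (forall u, cmod (f u) <= k) ->
  Cintegral (distribution P (rv_of mX)) setT f = Cintegral P setT (fun w => f (X w)).
Proof.
move=> mf fk; have [i1 i2] := cintegrable_bounded (cmeasurable_comp mX mf) (fun w => fk (X w)).
have [mf1 mf2] := mf.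
by apply: complex_ext; rewrite /= /Rintegral integral_distribution//; exact/measurable_EFinP.
Qed.

End change_of_variables.

Section complex_fubini.
Context {R : realType} {d1 d2} {T1 : measurableType d1} {T2 : measurableType d2}.
Variables (m1 : {sigma_finite_measure set T1 -> \bar R}) (m2 : probability T2 R).

(** Domination by a function of the first coordinate, integrable against [m1],
    makes every section of the integrand integrable, since [m2] is a
    probability; hence the two iterated integrals have no exceptional points. *)
Section real_part.
Variables (r : T1 * T2 -> R) (h : T1 -> R).
Hypotheses (mr : measurable_fun setT r) (hi : m1.-integrable setT (EFin \o h)).
Hypothesis rh : forall x y, `|r (x, y)| <= h x.

Lemma integrable_prod_dominated : (m1 \x m2)%E.-integrable setT (EFin \o r).
Proof.
apply/integrable12ltyP; first exact/measurable_EFinP.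
have h_lty : (\int[m1]_x (h x)%:E < +oo)%E.
  by rewrite ltey_eq; apply/orP; left; exact: integrable_fin_num hi.
apply: le_lt_trans h_lty; apply: ge0_le_integral => //.
- by move=> x _; exact: integral_ge0.
- have mE : measurable_fun setT (EFin \o r) by exact/measurable_EFinP.
  apply: (measurable_fun_fubini_tonelli_F (abse \o (EFin \o r))) => [|p]; last exact: abse_ge0.
  by apply: measurableT_comp mE; exact: abse_measurable.
- by case/integrableP: hi.
move=> x _; apply: (@le_trans _ _ (\int[m2]_y (h x)%:E)%E).
  apply: ge0_le_integral => //.
    apply: measurableT_comp => //; apply/measurable_EFinP.
    exact: (measurableT_comp mr (pair1_measurable x)).
  by move=> y _ /=; rewrite lee_fin rh.
by rewrite (integral_cst m2 measurableT) [X in (_ * X <= _)%E](probability_setT m2) mule1.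
Qed.

Lemma Rintegral_prod12 :
  Rintegral (m1 \x m2)%E setT r = \int[m1]_x \int[m2]_y r (x, y).
Proof.
rewrite /Rintegral -(integral12_prod_meas1 integrable_prod_dominated); congr fine.
apply: eq_integral => x _; rewrite /fubini_F /= fineK//.
apply: integrable_fin_num => //.
have hk : m2.-integrable setT (EFin \o cst (h x)) by exact: finite_measure_integrable_cst.
apply: le_integrable hk => //.
  by apply/measurable_EFinP; exact: (measurableT_comp mr (pair1_measurable x)).
by move=> y _ /=; rewrite lee_fin (le_trans (rh x y))// ler_norm.
Qed.

Lemma Rintegral_prod21 :
  Rintegral (m1 \x m2)%E setT r = \int[m2]_y \int[m1]_x r (x, y).
Proof.
rewrite /Rintegral -(integral21_prod_meas1 integrable_prod_dominated); congr fine.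
apply: eq_integral => y _; rewrite /fubini_G /= fineK//.
apply: integrable_fin_num => //; apply: le_integrable hi => //.
  by apply/measurable_EFinP; exact: (measurableT_comp mr (pair2_measurable y)).
by move=> x _ /=; rewrite lee_fin (le_trans (rh x y))// ler_norm.
Qed.

Lemma measurable_Rintegral_prod21 :
  measurable_fun setT (fun y => \int[m1]_x r (x, y)).
Proof.
exact: (measurableT_comp (fine_measurable measurableT)
  (measurable_fubini_G integrable_prod_dominated)).
Qed.

End real_part.

Variables (f : T1 * T2 -> R[i]) (h : T1 -> R).
Hypotheses (mf : cmeasurable f) (hi : m1.-integrable setT (EFin \o h)).
Hypothesis fh : forall x y, cmod (f (x, y)) <= h x.

Lemma cintegrable_prod : cintegrable (m1 \x m2)%E f.
Proof.
case: mf => mf1 mf2; split.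
  by apply: (integrable_prod_dominated mf1 hi) => x y; apply: le_trans (fh x y); exact: cmod_Re.
by apply: (integrable_prod_dominated mf2 hi) => x y; apply: le_trans (fh x y); exact: cmod_Im.
Qed.

Lemma cint_prod12 : Cintegral (m1 \x m2)%E setT f =
  Cintegral m1 setT (fun x => Cintegral m2 setT (fun y => f (x, y))).
Proof.
case: mf => mf1 mf2; apply: complex_ext => /=.
- by rewrite (Rintegral_prod12 mf1 hi)// => x y; apply: le_trans (fh x y); exact: cmod_Re.
- by rewrite (Rintegral_prod12 mf2 hi)// => x y; apply: le_trans (fh x y); exact: cmod_Im.
Qed.

Lemma cint_prod21 : Cintegral (m1 \x m2)%E setT f =
  Cintegral m2 setT (fun y => Cintegral m1 setT (fun x => f (x, y))).
Proof.
case: mf => mf1 mf2; apply: complex_ext => /=.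
- by rewrite (Rintegral_prod21 mf1 hi)// => x y; apply: le_trans (fh x y); exact: cmod_Re.
- by rewrite (Rintegral_prod21 mf2 hi)// => x y; apply: le_trans (fh x y); exact: cmod_Im.
Qed.

Lemma cmeasurable_cint_prod21 :
  cmeasurable (fun y => Cintegral m1 setT (fun x => f (x, y))).
Proof.
case: mf => mf1 mf2; split.
  by apply: (measurable_Rintegral_prod21 mf1 hi) => x y; apply: le_trans (fh x y); exact: cmod_Re.
by apply: (measurable_Rintegral_prod21 mf2 hi) => x y; apply: le_trans (fh x y); exact: cmod_Im.
Qed.

End complex_fubini.

(** * Independence *)

Section independent_sigma_algebras.
Context {R : realType} {d} {T : measurableType d} (P : probability T R).
Variables G1 G2 : set (set T).
Hypotheses (G1m : <<s G1 >> `<=` measurable) (G2m : <<s G2 >> `<=` measurable).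
Hypothesis G12 : independent_sigma P <<s G1 >> <<s G2 >>.

Local Notation T1 := (g_sigma_algebraType G1).
Local Notation T2 := (g_sigma_algebraType G2).

Let mid1 : measurable_fun setT (id : T -> T1).
Proof. by move=> _ B mB; rewrite setTI preimage_id; exact: G1m. Qed.

Let mid2 : measurable_fun setT (id : T -> T2).
Proof. by move=> _ B mB; rewrite setTI preimage_id; exact: G2m. Qed.

(** Independence says that the diagonal embedding of [T] into the product of
    the two coarser measurable spaces pushes [P] to a product measure, so that
    Fubini freezes one of the two sources of randomness. *)
Lemma independent_freeze (F : T -> T -> R[i]) (k : R) :
  cmeasurable (fun p : T1 * T2 => F p.1 p.2) -> (forall w1 w2, cmod (F w1 w2) <= k) ->
  Cexpectation P (fun w => F w w) =
  Cexpectation P (fun w2 => Cexpectation P (fun w1 => F w1 w2)).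
Proof.
move=> mF Fk.
have m1 := mid1; have m2 := mid2.
pose P1 : probability T1 R := distribution P (rv_of P m1).
pose P2 : probability T2 R := distribution P (rv_of P m2).
have mD : measurable_fun setT (fun w : T => (w : T1, w : T2)).
  exact: measurable_fun_pair.
pose D := distribution P (rv_of P mD).
have DE A : measurable A -> D A = (P1 \x P2)%E A.
  move=> mA; apply/esym; apply: (product_measure_unique (m' := D)) mA.
  by move=> A1 A2 mA1 mA2; exact: (G12 mA1 mA2).
transitivity (Cintegral D setT (fun p : T1 * T2 => F p.1 p.2)).
  by rewrite (cint_distribution P mD mF (k := k)).
transitivity (Cintegral (P1 \x P2)%E setT (fun p : T1 * T2 => F p.1 p.2)).
  by apply: complex_ext; rewrite /= /Rintegral; congr fine;
    apply: eq_measure_integral => A mA _; exact: DE.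
rewrite (cint_prod21 P2 mF (finite_measure_integrable_cst P1 k measurableT) Fk).
have mF2 w2 : cmeasurable (fun w1 : T1 => F w1 w2).
  exact: (cmeasurable_comp (pair2_measurable (w2 : T2)) mF).
have E w2 : Cintegral P1 setT (fun w1 : T1 => F w1 w2) = Cexpectation P (fun w1 => F w1 w2).
  exact: (cint_distribution P m1 (mF2 w2) (k := k)).
have ki := finite_measure_integrable_cst P1 k measurableT.
have mE := cmeasurable_cint_prod21 P2 mF ki Fk.
transitivity (Cintegral P2 setT (fun w2 => Cexpectation P (fun w1 => F w1 w2))).
  exact: eq_cint.
apply: (cint_distribution P m2 (k := k)) => [|w2].
  exact: cmeasurable_ext mE.
by rewrite -E; exact: cmod_Cexpectation_le.
Qed.

Lemma independent_expectationM (f g : T -> R[i]) (k : R) :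
  cmeasurable (f : T1 -> R[i]) -> cmeasurable (g : T2 -> R[i]) ->
  (forall w, cmod (f w) <= k) -> (forall w, cmod (g w) <= k) ->
  Cexpectation P (fun w => f w * g w) = Cexpectation P f * Cexpectation P g.
Proof.
move=> mf mg fk gk.
have fi : cintegrable P f := cintegrable_bounded P (cmeasurable_comp mid1 mf) fk.
have gi : cintegrable P g := cintegrable_bounded P (cmeasurable_comp mid2 mg) gk.
rewrite (@independent_freeze (fun w1 w2 => f w1 * g w2) (k * k)); last 2 first.
- by apply: cmeasurableM; [exact: cmeasurable_comp measurable_fst mf
    | exact: cmeasurable_comp measurable_snd mg].
- by move=> w1 w2; rewrite cmodM ler_pM// cmod_ge0.
rewrite -cintZ//; apply: eq_cint => w2; rewrite mulrC -cintZ//.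
by apply: eq_cint => w1; rewrite mulrC.
Qed.

End independent_sigma_algebras.

Section mutual_independence.
Context {R : realType} {d} {T : measurableType d} (P : probability T R).

(** [sigma_of D X] is the sigma-algebra generated by this family. The family
    itself is needed to view [T] as a coarser measurable space. *)
Definition generators {I : Type} (D : set I) {d'} {U : measurableType d'} (X : I -> T -> U) :
  set (set T) := \bigcup_(i in D) preimage_set_system setT (X i) measurable.

Lemma measurable_generators {I : Type} (D : set I) {d'} {U : measurableType d'}
    (X : I -> T -> U) i :
  D i -> measurable_fun setT (X i : g_sigma_algebraType (generators D X) -> U).
Proof.
move=> Di _ B mB; rewrite setTI; apply: sub_sigma_algebra.
by exists i => //; exists B => //; rewrite setTI.
Qed.

Lemma sigma_of_measurable {I : Type} (D : set I) {d'} {U : measurableType d'}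
    (X : I -> T -> U) :
  (forall i, D i -> measurable_fun setT (X i)) -> sigma_of D X `<=` measurable.
Proof.
move=> mX; apply: smallest_sub; first exact: sigma_algebra_measurable.
by move=> A [i Di [B mB <-]]; exact: mX.
Qed.

Context {d'} {U : measurableType d'} (X : nat -> T -> U).
Hypothesis mX : forall i, measurable_fun setT (X i).
Hypothesis indepX : mutually_independent P X.

(** The finite intersections of events about [X 0, .., X (n - 1)] form a
    pi-system, on which independence from [X n] is the product rule. *)
Lemma independent_prefix n :
  independent_sigma P (sigma_of [set i | (i < n)%N] X) (sigma_of [set n] X).
Proof.
pose H := [set A : set T | exists B : nat -> set U, (forall i, measurable (B i)) /\
  A = \bigcap_(i in [set` iota 0 n]) X i @^-1` B i].
have mpre i C : measurable C -> measurable (X i @^-1` C).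
  by move=> mC; rewrite -[_ @^-1` _]setTI; exact: mX.
have Hm : H `<=` measurable.
  by move=> _ [B [mB ->]]; apply: bigcap_measurableType => i _; exact: mpre.
have HT : H setT.
  exists (fun=> setT); split => //; apply/esym.
  by rewrite -subTset => w _ i _.
have HI : setI_closed H.
  move=> _ _ [B [mB ->]] [C [mC ->]]; exists (fun i => B i `&` C i); split.
    by move=> i; exact: measurableI.
  rewrite -bigcapI; apply: eq_bigcapr => i _.
  by rewrite preimage_setI.
have sigmaH : sigma_of [set i | (i < n)%N] X `<=` <<s H >>.
  apply: smallest_sub; first exact: smallest_sigma_algebra.
  move=> A [i /= iltn [C mC <-]]; apply: sub_sigma_algebra.
  exists (fun j => if j == i then C else setT); split.
    by move=> j; case: ifP.
  rewrite setTI; apply/seteqP; split=> w /=.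
    by move=> XC j _; case: eqP => // ->.
  by move=> /(_ i); rewrite /= eqxx; apply; rewrite mem_iota.
move=> A1 A2 /sigmaH HA1 HA2.
have [C mC ->] : exists2 C, measurable C & A2 = X n @^-1` C.
  have : preimage_set_system setT (X n) measurable A2.
    have := HA2; rewrite /sigma_of bigcup_set1; apply: smallest_sub => //.
    exact: sigma_algebra_preimage (sigma_algebra_measurable _).
  by case=> C mC <-; exists C => //; rewrite setTI.
have PCfin : P (X n @^-1` C) \is a fin_num by exact: fin_num_measure (mpre _ _ mC).
have PC0 : 0 <= fine (P (X n @^-1` C)) by rewrite fine_ge0.
pose m1 : {measure set T -> \bar R} := mrestr P (mpre n C mC).
pose m2 : {measure set T -> \bar R} := mscale (NngNum PC0) P.
suff E12 : m1 A1 = m2 A1.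
  rewrite -[LHS]/(m1 A1) E12 -[LHS]/((fine (P (X n @^-1` C)))%:E * P A1)%E.
  by rewrite fineK// muleC.
have U0 : \bigcup_(k : nat) (fun=> setT : set T) k = setT by rewrite bigcup_const.
apply: (@g_sigma_algebra_measure_unique _ _ _ H Hm _ (fun _ : nat => HT) U0 m1 m2 HI) => //.
- move=> _ [B [mB ->]].
  rewrite -[LHS]/(P (_ `&` X n @^-1` C)) -[RHS]/((fine (P (X n @^-1` C)))%:E * P _)%E fineK//.
  pose B' i := if i == n then C else B i.
  have -> : \bigcap_(i in [set` iota 0 n]) X i @^-1` B i `&` X n @^-1` C =
      \bigcap_(i in [set` n :: iota 0 n]) X i @^-1` B' i.
    apply/seteqP; split=> w /=.
      move=> [wB wC] i /=; rewrite inE /B'; case: eqP => [->//|_ /=]; exact: wB.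
    move=> wB; split; last by have := wB n; rewrite /= inE /B' eqxx; apply.
    move=> i /= ilt; have := wB i; rewrite /= inE ilt orbT /B' => /(_ isT).
    by case: eqP ilt => // ->; rewrite mem_iota ltnn andbF.
  rewrite !indepX ?iota_uniq//.
  - rewrite big_cons /B' eqxx; congr (_ * _)%E; apply: eq_big_seq => i.
    by rewrite mem_iota add0n => /andP[_]; case: eqP => // ->; rewrite ltnn.
  - by rewrite /= iota_uniq mem_iota ltnn.
  - by move=> i; rewrite /B'; case: ifP.
- by move=> _; rewrite -[m1 _]/(P _) setTI ltey_eq PCfin.
Qed.

(** Peel off the last factor: it is independent from the sigma-algebra of all
    the earlier ones. *)
Lemma expectation_prod_independent (f : nat -> U -> R[i]) :
  (forall i, cmeasurable (f i)) -> (forall i x, cmod (f i x) <= 1) ->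
  forall n, Cexpectation P (fun w => \prod_(i < n) f i (X i w)) =
    \prod_(i < n) Cexpectation P (fun w => f i (X i w)).
Proof.
move=> mf f1; elim=> [|n IHn].
  rewrite big_ord0; apply: etrans (Cexpectation_cst P 1).
  by apply: eq_cint => w; rewrite big_ord0.
rewrite big_ord_recr/= -IHn.
have m1 := sigma_of_measurable (fun i (_ : [set i | (i < n)%N] i) => mX i).
have m2 := sigma_of_measurable (fun i (_ : [set n] i) => mX i).
have mp : cmeasurable ((fun w => \prod_(i < n) f i (X i w)) :
    g_sigma_algebraType (generators [set i | (i < n)%N] X) -> R[i]).
  apply: cmeasurable_prod => i; apply: cmeasurable_comp (mf i).
  exact: (@measurable_generators _ [set i | (i < n)%N] _ _ X i (ltn_ord i)).
have mn : cmeasurable ((fun w => f n (X n w)) :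
    g_sigma_algebraType (generators [set n] X) -> R[i]).
  by apply: cmeasurable_comp (mf n); exact: measurable_generators.
rewrite -(independent_expectationM m1 m2 (@independent_prefix n) mp mn (k := 1)) => [|w|w].
- by apply: eq_cint => w; rewrite big_ord_recr.
- by elim/big_ind: _ => [|z z' z1 z1'|i _]; rewrite ?cmod1// cmodM_le1.
- exact: f1.
Qed.

End mutual_independence.
(** * Integer-valued variables and processes *)

Section discrete_measurability.
Context {d} {T : measurableType d}.

Lemma measurable_nat_fiber (N : T -> nat) n :
  measurable_fun setT N -> measurable [set w | N w = n].
Proof.
by move=> mN; rewrite -[X in measurable X]setTI; exact: (mN measurableT [set n]).
Qed.

Lemma measurable_of_nat_fibers (N : T -> nat) :
  (forall n, measurable [set w | N w = n]) -> measurable_fun setT N.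
Proof.
move=> mN _ B _; rewrite setTI.
have -> : N @^-1` B = \bigcup_(n in B) [set w | N w = n].
  by apply/seteqP; split=> [w Bw|w [n Bn /= nE]]; [exists (N w)|rewrite /= nE].
by apply: bigcup_measurable => n _; exact: mN.
Qed.

Lemma measurable_nat2 {d'} {U : measurableType d'} (F : nat -> nat -> U) (N1 N2 : T -> nat) :
  measurable_fun setT N1 -> measurable_fun setT N2 ->
  measurable_fun setT (fun w => F (N1 w) (N2 w)).
Proof.
move=> m1 m2 _ B mB; rewrite setTI.
have -> : (fun w => F (N1 w) (N2 w)) @^-1` B =
    \bigcup_i \bigcup_(j in [set j | B (F i j)]) ([set w | N1 w = i] `&` [set w | N2 w = j]).
  apply/seteqP; split=> [w Bw|w [i _ [j Bij [/= iE jE]]]]; last by rewrite /= iE jE.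
  by exists (N1 w) => //; exists (N2 w).
apply: bigcup_measurable => i _; apply: bigcup_measurable => j _.
by apply: measurableI; exact: measurable_nat_fiber.
Qed.

Lemma measurable_nat_sum n (p : nat -> T -> bool) (F : nat -> T -> nat) :
  (forall i, measurable_fun setT (p i)) -> (forall i, measurable_fun setT (F i)) ->
  measurable_fun setT (fun w => \sum_(i < n | p i w) F i w)%N.
Proof.
move=> mp mF; elim: n => [|n IHn].
  by under eq_fun do rewrite big_ord0; exact: measurable_cst.
under eq_fun do rewrite big_mkcond big_ord_recr/= -big_mkcond/=.
apply: (measurable_nat2 addn) => //.
by apply: measurable_fun_ifT => //; exact: measurable_cst.
Qed.

Lemma measurable_eventually_constant {d'} {U : measurableType d'}
    (F : nat -> T -> U) (G : T -> U) :
  (forall n, measurable_fun setT (F n)) ->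
  (forall w, exists N, forall n, (N <= n)%N -> F n w = G w) ->
  measurable_fun setT G.
Proof.
move=> mF FG _ B mB; rewrite setTI.
have -> : G @^-1` B = \bigcup_N \bigcap_(n in [set n | (N <= n)%N]) (F n @^-1` B).
  apply/seteqP; split=> w /=.
    by move=> BG; have [N HN] := FG w; exists N => // n /= Nn; rewrite HN.
  move=> [N _ H]; have [N' HN'] := FG w.
  by have := H (maxn N N') (leq_maxl _ _); rewrite /= HN'// leq_maxr.
apply: bigcup_measurable => N _; apply: bigcap_measurableType => n _.
by rewrite -[X in measurable X]setTI; exact: mF.
Qed.

End discrete_measurability.

Lemma cmeasurable_eventually_constant (R : realType) d (T : measurableType d)
    (F : nat -> T -> R[i]) (f : T -> R[i]) :
  (forall n, cmeasurable (F n)) ->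
  (forall w, exists N, forall n, (N <= n)%N -> F n w = f w) -> cmeasurable f.
Proof.
move=> mF Ff; split.
  apply: (measurable_eventually_constant (fun n => (mF n).1)) => w.
  by have [N HN] := Ff w; exists N => n /HN ->.
apply: (measurable_eventually_constant (fun n => (mF n).2)) => w.
by have [N HN] := Ff w; exists N => n /HN ->.
Qed.

(** A right-continuous integer-valued process is sampled by a random time
    through the grid points just above it, which take countably many values. *)
Lemma measurable_right_continuous_sampling (R : realType) d d' (W : measurableType d)
    (V : measurableType d') (B : R -> V -> nat) (S : W -> R) (X : W -> V) :
  (forall s, 0 <= s -> measurable_fun setT (B s)) ->
  (forall s v, 0 <= s -> exists2 e : R, 0 < e &
     forall s', s <= s' -> s' <= s + e -> B s' v = B s v) ->
  measurable_fun setT S -> (forall w, 0 <= S w) -> measurable_fun setT X ->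
  measurable_fun setT (fun w => B (S w) (X w)).
Proof.
move=> mB rcB mS S0 mX.
pose grid n (s : R) := (Num.truncn (s * n.+1%:R)).+1%:R / n.+1%:R : R.
apply: (measurable_eventually_constant (F := fun n w => B (grid n (S w)) (X w))).
  move=> n; apply: measurable_of_nat_fibers => j.
  have -> : [set w | B (grid n (S w)) (X w) = j] = \bigcup_k
      ([set w | (k%:R <= S w * n.+1%:R) && (S w * n.+1%:R < k.+1%:R)] `&`
       X @^-1` [set v | B (k.+1%:R / n.+1%:R) v = j]).
    have S'0 w : 0 <= S w * n.+1%:R by rewrite mulr_ge0.
    apply/seteqP; split=> w /=.
      move=> Bj; exists (Num.truncn (S w * n.+1%:R)) => //.
      by split => //=; exact: truncn_itv.
    by move=> [k _ [/truncn_def kE /= <-]]; rewrite /grid kE.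
  apply: bigcup_measurable => k _; apply: measurableI.
    have mSn : measurable_fun setT (fun w => S w * n.+1%:R).
      by apply: measurable_funM => //; exact: measurable_cst.
    rewrite -[X in measurable X]setTI.
    apply: (_ : measurable_fun setT
      (fun w => (k%:R <= S w * n.+1%:R) && (S w * n.+1%:R < k.+1%:R))) => //.
    apply: measurable_and; [apply: measurable_fun_ler|apply: measurable_fun_ltr] => //;
      exact: measurable_cst.
  rewrite -[X in measurable X]setTI; apply: mX => //.
  by apply: measurable_nat_fiber; apply: mB; rewrite divr_ge0.
move=> w; have [e e0 He] := rcB (S w) (X w) (S0 w).
exists (Num.truncn e^-1) => n en.
have n0 : 0 < n.+1%:R :> R by rewrite ltr0n.
have /andP[t1 t2] := truncn_itv (mulr_ge0 (S0 w) (ltW n0)).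
apply: He; first by rewrite ler_pdivlMr// ltW.
rewrite ler_pdivrMr// mulrDl -natr1 lerD// -ler_pdivrMl ?mulr1//.
apply: (@le_trans _ _ (Num.truncn e^-1).+1%:R); last by rewrite ler_nat ltnS.
by rewrite ltW// truncnS_gt.
Qed.

(** * Sums of marks *)

Section marked_sum_facts.
Context {R : realType} {d} {T : measurableType d}.
Variables (t : nat -> T -> R) (a : nat -> T -> nat).
Hypothesis locally_finite : forall s w, finite_set [set k | t k w <= s].

Lemma points_bound s w : exists N, forall k, t k w <= s -> (k < N)%N.
Proof.
have /finite_seqP[r Er] := locally_finite s w.
exists (\max_(k <- r) k).+1 => k tk; rewrite ltnS.
have : [set` r] k by rewrite -Er.
by move=> /= kr; rewrite (big_rem k)//= leq_maxl.
Qed.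

Lemma marked_sum_trunc s w N : (forall k, t k w <= s -> (k < N)%N) ->
  marked_sum t a s w = (\sum_(k < N | (t k w <= s)%R) a k w)%N.
Proof.
move=> tN; rewrite /marked_sum (@fsbigE _ _ _ _ _ [seq k <- iota 0 N | t k w <= s]).
- rewrite big_filter_cond -{1}[N]subn0 big_mkord; apply: eq_bigl => k.
  by have [tk|//] := boolP (t k w <= s); rewrite mem_set.
- by rewrite filter_uniq ?iota_uniq.
- by move=> k /=; rewrite mem_filter => /andP[].
- by move=> k /= tk; rewrite mem_filter tk mem_iota (tN _ tk).
Qed.

Lemma marked_sum_mono s s' w : s <= s' -> (marked_sum t a s w <= marked_sum t a s' w)%N.
Proof.
move=> ss'; have [N HN] := points_bound s' w.
have HN' k : t k w <= s -> (k < N)%N by move=> tk; apply: HN; exact: le_trans tk ss'.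
rewrite (marked_sum_trunc HN) (marked_sum_trunc HN') big_mkcond [leqRHS]big_mkcond.
by apply: leq_sum => k _; case: ifP => // tk; rewrite (le_trans tk ss').
Qed.

(** Only finitely many points lie below [s + 1], so those beyond [s] stay at a
    positive distance from it. *)
Lemma marked_sum_right_continuous s w : exists2 e : R, 0 < e &
  forall s', s <= s' -> s' <= s + e -> marked_sum t a s' w = marked_sum t a s w.
Proof.
have [N HN] := points_bound (s + 1) w.
have [e /andP[e0 e1] He] : exists2 e : R, 0 < e <= 1 &
    forall k, (k < N)%N -> s < t k w -> s + e < t k w.
  elim: N {HN} => [|N [e /andP[e0 e1] He]]; first by exists 1; rewrite ?ltr01 ?lexx.
  have [tN|tN] := ltP s (t N w); last first.
    exists e => [|k]; first by rewrite e0.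
    by rewrite ltnS leq_eqVlt => /orP[/eqP->|/He//]; rewrite ltNge tN.
  have tN0 : 0 < (t N w - s) / 2 by rewrite divr_gt0// subr_gt0.
  exists (Num.min e ((t N w - s) / 2)) => [|k].
    by rewrite lt_min e0 tN0 ge_min e1.
  rewrite ltnS leq_eqVlt => /orP[/eqP->|kN sk].
    move=> _; apply: (@le_lt_trans _ _ (s + (t N w - s) / 2)); last by lra.
    by rewrite lerD2l ge_min lexx orbT.
  by apply: le_lt_trans (He _ kN sk); rewrite lerD2l ge_min lexx.
exists e => // s' ss' s'e.
have HN' k : t k w <= s' -> (k < N)%N.
  by move=> tk; apply: HN; apply: le_trans tk (le_trans s'e _); rewrite lerD2l.
have HN'' k : t k w <= s -> (k < N)%N by move=> tk; apply: HN'; exact: le_trans tk ss'.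
rewrite (marked_sum_trunc HN') (marked_sum_trunc HN''); apply: eq_bigl => k.
have [ts|st] := leP (t k w) s; first by rewrite (le_trans ts).
by apply/negbTE; rewrite -ltNge; apply: le_lt_trans s'e (He _ (ltn_ord k) st).
Qed.

Lemma measurable_marked_sum s :
  (forall k, measurable_fun setT (t k)) -> (forall k, measurable_fun setT (a k)) ->
  measurable_fun setT (marked_sum t a s).
Proof.
move=> mt ma.
apply: (measurable_eventually_constant
  (F := fun N w => (\sum_(k < N | (t k w <= s)%R) a k w)%N)).
  move=> N; apply: (@measurable_nat_sum _ _ N (fun k w => t k w <= s) a) => // i.
  by apply: measurable_fun_ler => //; exact: measurable_cst.
move=> w; have [N HN] := points_bound s w; exists N => n Nn.
by rewrite -marked_sum_trunc// => k /HN kN; exact: leq_trans kN Nn.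
Qed.

End marked_sum_facts.
(** * Complex-valued curves and the exponential *)

Section complex_curves.
Context {R : realType}.
Implicit Types (f g : R -> R[i]) (s : R) (z : R[i]).

Definition is_cderive f s (df : R[i]) :=
  is_derive s 1 (fun r => Re (f r)) (Re df) /\ is_derive s 1 (fun r => Im (f r)) (Im df).

Lemma is_cderive_ext f g s z : f =1 g -> is_cderive f s z -> is_cderive g s z.
Proof. by move=> /funext->. Qed.

Lemma is_cderive_cst (c : R[i]) s : is_cderive (fun=> c) s 0.
Proof. by split; exact: is_derive_cst. Qed.

Lemma is_cderiveD f g s df dg : is_cderive f s df -> is_cderive g s dg ->
  is_cderive (fun r => f r + g r) s (df + dg).
Proof.
move=> [f1 f2] [g1 g2]; split.
  by under eq_fun do rewrite cReD; rewrite cReD; exact: is_deriveD.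
by under eq_fun do rewrite cImD; rewrite cImD; exact: is_deriveD.
Qed.

Lemma is_cderiveM f g s df dg : is_cderive f s df -> is_cderive g s dg ->
  is_cderive (fun r => f r * g r) s (df * g s + f s * dg).
Proof.
move=> [f1 f2] [g1 g2]; split.
  under eq_fun do rewrite cReM.
  apply: is_derive_eq; rewrite /GRing.scale/= cReD !cReM; ring.
under eq_fun do rewrite cImM.
apply: is_derive_eq; rewrite /GRing.scale/= cImD !cImM; ring.
Qed.

Lemma is_cderive_exprn n s : is_cderive (fun r => (r ^+ n.+1)%:C) s (n.+1%:R * s ^+ n)%:C.
Proof.
split => /=; last exact: is_derive_cst.
elim: n => [|n IHn].
  under eq_fun do rewrite expr1; apply: is_derive_eq; rewrite expr0 mulr1//.
under eq_fun do rewrite exprS.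
by apply: is_derive_eq; rewrite /GRing.scale/= -[in RHS]natr1 !exprS; ring.
Qed.

Lemma is_cderive_cexp z s : is_cderive (fun r => cexp (z * r%:C)) s (z * cexp (z * s%:C)).
Proof.
have E1 k : is_derive s 1 (fun r : R => k * r) k.
  by apply: is_derive_eq; rewrite /GRing.scale/=; ring.
split.
  under eq_fun do rewrite Re_cexp cReMr cImMr.
  by apply: is_derive_eq; rewrite /GRing.scale/= cReM Re_cexp Im_cexp cReMr cImMr; ring.
under eq_fun do rewrite Im_cexp cReMr cImMr.
by apply: is_derive_eq; rewrite /GRing.scale/= cImM Re_cexp Im_cexp cReMr cImMr; ring.
Qed.

Lemma is_cderiveZ z f s df : is_cderive f s df -> is_cderive (fun r => z * f r) s (z * df).
Proof.
move=> fd; have := is_cderiveM (is_cderive_cst z s) fd.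
by rewrite mul0r add0r.
Qed.

Lemma cmod_mean_value f (df : R -> R[i]) (k : R) :
  (forall s, is_cderive f s (df s)) -> (forall s, 0 <= s <= 1 -> cmod (df s) <= k) ->
  cmod (f 1 - f 0) <= k + k.
Proof.
move=> fd dfk; apply: le_trans (cmod_le _) _.
have mvt (h dh : R -> R) : (forall s : R, is_derive s 1 h (dh s)) ->
    (forall s, 0 <= s <= 1 -> `|dh s| <= k) -> `|h 1 - h 0| <= k.
  move=> hd dhk; have [|c] := @MVT_segment R h dh 0 1 ler01 (fun s _ => hd s).
    apply: continuous_subspaceT => s; apply: differentiable_continuous.
    by apply/derivable1_diffP; have [] := hd s.
  by rewrite in_itv/= subr0 mulr1 => c01 ->; exact: dhk.
rewrite cReD cReN cImD cImN; apply: lerD.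
  by apply: (mvt (fun s => Re (f s)) (fun s => Re (df s))) => s; [case: (fd s)|move=> s01; exact: le_trans (cmod_Re _) (dfk _ s01)].
by apply: (mvt (fun s => Im (f s)) (fun s => Im (df s))) => s; [case: (fd s)|move=> s01; exact: le_trans (cmod_Im _) (dfk _ s01)].
Qed.

(** The partial sums p_m of the exponential series satisfy p_(m+1)' = z p_m
    along the ray r |-> r z, so p_(m+1) exp(- r z) has derivative
    - z (r z)^m exp(- r z) / m!, which tends to 0: the product stays close to
    its value 1 at r = 0. *)
Lemma cexp_series z : ccvg (fun m => \sum_(k < m) (k`!%:R^-1)%:C * z ^+ k) (cexp z).
Proof.
pose p m (r : R) := \sum_(k < m) (k`!%:R^-1)%:C * ((r ^+ k)%:C * z ^+ k).
have pd m r : is_cderive (p m.+1) r (z * p m r).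
  elim: m => [|m IHm].
    rewrite /p big_ord0 mulr0.
    apply: (is_cderive_ext (f := fun=> 1)); last exact: is_cderive_cst.
    by move=> x; rewrite big_ord_recr big_ord0 /= fact0 invr1 !expr0 !mulr1 add0r.
  apply: (is_cderive_ext (f := fun x => p m.+1 x +
      ((m.+1)`!%:R^-1)%:C * z ^+ m.+1 * (x ^+ m.+1)%:C)).
    by move=> x; rewrite [RHS]big_ord_recr/=; congr (_ + _); rewrite -mulrA (mulrC (z ^+ _)).
  have -> : z * p m.+1 r = z * p m r +
      ((m.+1)`!%:R^-1)%:C * z ^+ m.+1 * (m.+1%:R * r ^+ m)%:C.
    rewrite {1}/p big_ord_recr/= mulrDr; congr (_ + _).
    have -> : (m`!%:R^-1)%:C = ((m.+1)`!%:R^-1)%:C * m.+1%:R%:C :> R[i].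
      by rewrite -rmorphM/= factS natrM invfM mulrAC mulVf ?mul1r// pnatr_eq0.
    by rewrite (rmorphM _ m.+1%:R) exprS; ring.
  by apply: is_cderiveD => //; apply: is_cderiveZ; exact: is_cderive_exprn.
pose q m (r : R) := p m.+1 r * cexp (- z * r%:C).
have qd m r : is_cderive (q m) r
    (- (m`!%:R^-1)%:C * (r ^+ m)%:C * z ^+ m.+1 * cexp (- z * r%:C)).
  have := is_cderiveM (pd m r) (is_cderive_cexp (- z) r).
  have -> : p m.+1 r = p m r + (m`!%:R^-1)%:C * ((r ^+ m)%:C * z ^+ m).
    by rewrite /p big_ord_recr.
  by congr is_cderive; rewrite exprS; ring.
pose K := expR (cmod z).
have qk m r : 0 <= r <= 1 ->
    cmod (- (m`!%:R^-1)%:C * (r ^+ m)%:C * z ^+ m.+1 * cexp (- z * r%:C))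
      <= cmod z * K * (cmod z ^+ m / m`!%:R).
  move=> /andP[r0 r1]; rewrite cmodM cmod_cexp !cmodM cmodN !cmodR cmodX.
  have -> : cmod z * K * (cmod z ^+ m / m`!%:R) = `|m`!%:R^-1| * 1 * cmod z ^+ m.+1 * K.
    by rewrite ger0_norm ?invr_ge0// exprS; ring.
  apply: ler_pM => //; rewrite ?expR_ge0 ?mulr_ge0 ?exprn_ge0 ?cmod_ge0//.
    rewrite ler_wpM2r ?exprn_ge0 ?cmod_ge0// ler_wpM2l//.
    by rewrite ger0_norm ?exprn_ge0// exprn_ile1.
  rewrite ler_expR cReMr (le_trans (ler_norm _))// normrM (ger0_norm r0).
  by apply: (le_trans (ler_piMr _ r1)) => //; rewrite cReN normrN cmod_Re.
have q0 m : q m 0 = 1.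
  rewrite /q mulr0 cexp0 mulr1 /p big_ord_recl big1 ?addr0/=.
    by rewrite fact0 invr1 !expr0 !mulr1.
  by move=> i _; rewrite expr0n/= mul0r mulr0.
pose e m := K * (cmod z * K * (cmod z ^+ m / m`!%:R) + cmod z * K * (cmod z ^+ m / m`!%:R)).
have e0 : e @ \oo --> 0.
  have -> : e = fun m => (K * (cmod z * K) + K * (cmod z * K)) * exp_coeff (cmod z) m.
    by apply/funext => m; rewrite /e /exp_coeff/=; ring.
  rewrite -[X in _ --> X](mulr0 (K * (cmod z * K) + K * (cmod z * K))).
  by apply: cvgMl_tmp; exact: cvg_exp_coeff.
have cS : ccvg (fun m => \sum_(k < m.+1) (k`!%:R^-1)%:C * z ^+ k) (cexp z).
  apply: (ccvg_squeeze _ e0) => m.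
  have := cmod_mean_value (qd m) (qk m); rewrite q0.
  have -> : \sum_(k < m.+1) (k`!%:R^-1)%:C * z ^+ k - cexp z = cexp z * (q m 1 - 1).
    rewrite mulrBr mulr1 /q mulr1 mulrCA [_ * cexp (- z)]mulrC cexpN mulr1.
    by congr (_ - _); apply: eq_bigr => k _; rewrite expr1n mul1r.
  rewrite cmodM => /(ler_wpM2l (cmod_ge0 (cexp z))) H; apply: le_trans H _.
  rewrite /e; apply: ler_wpM2r; last by rewrite cmod_cexp ler_expR (le_trans (ler_norm _))// cmod_Re.
  have K0 : 0 <= K by exact: expR_ge0.
  have X0 : 0 <= cmod z ^+ m / m`!%:R by rewrite divr_ge0 ?exprn_ge0 ?cmod_ge0.
  by apply: addr_ge0; apply: mulr_ge0 => //; apply: mulr_ge0 => //; exact: cmod_ge0.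
case: cS => c1 c2; split.
  by rewrite -(cvg_shiftS (fun m => Re (\sum_(k < m) (k`!%:R^-1)%:C * z ^+ k))).
by rewrite -(cvg_shiftS (fun m => Im (\sum_(k < m) (k`!%:R^-1)%:C * z ^+ k))).
Qed.

End complex_curves.
(** * The generating function of a Poisson variable *)

Section poisson_generating_function.
Context {R : realType} {d} {T : measurableType d} (P : probability T R).

Lemma cmeasurable_if (b : T -> bool) (f g : T -> R[i]) : measurable_fun setT b ->
  cmeasurable f -> cmeasurable g -> cmeasurable (fun w => if b w then f w else g w).
Proof.
move=> mb mf mg.
apply: (cmeasurable_ext (f := fun w => (b w)%:R * f w + (~~ b w)%:R * g w)) => [w|].
  by case: (b w); rewrite !(mul1r, mul0r) ?addr0 ?add0r.
apply: cmeasurableD; apply: cmeasurableM => //; apply: cmeasurable_bool => //.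
exact: measurable_neg.
Qed.

Lemma same_law_Cexpectation {d'} {U : measurableType d'} (X Y : T -> U) (f : U -> R[i]) (k : R) :
  measurable_fun setT X -> measurable_fun setT Y -> same_law P X Y ->
  cmeasurable f -> (forall u, cmod (f u) <= k) ->
  Cexpectation P (fun w => f (X w)) = Cexpectation P (fun w => f (Y w)).
Proof.
move=> mX mY XY mf fk.
rewrite -[LHS](cint_distribution P mX mf fk) -[RHS](cint_distribution P mY mf fk).
by apply: complex_ext; rewrite /= /Rintegral; congr fine;
  apply: eq_measure_integral => A mA _; exact: XY.
Qed.

(** The partial sums of the expectation over the values of [N] are exp (- r)
    times those of the exponential series at [r z]. *)
Lemma poisson_pgf (N : T -> nat) (r : R) (z : R[i]) : measurable_fun setT N -> 0 < r ->
  (forall k, P [set w | N w = k] = (poisson_pmf r k)%:E) -> cmod z <= 1 ->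
  Cexpectation P (fun w => z ^+ N w) = cexp (r%:C * (z - 1)).
Proof.
move=> mN r0 NP z1.
pose S m w : R[i] := \sum_(k < m) (N w == k)%:R * z ^+ k.
have SE m w : S m w = if (N w < m)%N then z ^+ N w else 0.
  rewrite /S; case: ltnP => [Nm|mN'].
    rewrite (bigD1 (Ordinal Nm))//= eqxx mul1r big1 ?addr0// => i iN.
    case: eqP => [Ni|]; last by rewrite mul0r.
    by move: iN; rewrite -val_eqE/= Ni eqxx.
  rewrite big1// => i _; rewrite gtn_eqF ?mul0r//.
  exact: leq_trans (ltn_ord i) mN'.
have mb k : measurable_fun setT (fun w => N w == k).
  exact: (measurable_nat2 (fun i j => i == j) mN (measurable_cst k)).
have mS m : cmeasurable (S m).
  apply: cmeasurable_sum => i; apply: cmeasurableM; last exact: cmeasurable_cst.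
  exact: cmeasurable_bool.
have mz : cmeasurable (fun w => z ^+ N w) by exact: (cmeasurable_nat (fun n => z ^+ n) mN).
have C1 : ccvg (fun m => Cexpectation P (S m)) (Cexpectation P (fun w => z ^+ N w)).
  apply: (cdominated_convergence mS mz (finite_measure_integrable_cst P 1 measurableT)) => [m w|w].
    by rewrite SE; case: ifP; rewrite ?cmod0// cmodX_le1.
  by apply: (@ccvg_eventually _ _ _ (N w).+1) => n nN; rewrite SE nN.
apply: (ccvg_unique C1).
have Eb (k : nat) : Cexpectation P (fun w => (N w == k)%:R) = (poisson_pmf r k)%:C.
  apply: complex_ext => /=; rewrite /Rintegral.
    rewrite (eq_integral (fun w => (\1_[set w | N w = k] w)%:E)).
      rewrite integral_indic//; last exact: measurable_nat_fiber.
      by rewrite setIT [X in fine X](NP k).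
    by move=> w _; rewrite indicE /=; case: eqP => Nk; [rewrite mem_set|rewrite memNset].
  rewrite (eq_integral (cst 0%E)); first by rewrite integral0.
  by move=> w _; case: eqP.
have ES m : Cexpectation P (S m) =
    (expR (- r))%:C * \sum_(k < m) (k`!%:R^-1)%:C * (r%:C * z) ^+ k.
  rewrite [LHS]cint_sum => [|i]; last first.
    apply: (@cintegrable_bounded _ _ _ P _ 1) => [|w].
      by apply: cmeasurableM; [exact: cmeasurable_bool|exact: cmeasurable_cst].
    by case: eqP; rewrite ?mul1r ?mul0r ?cmod0// cmodX_le1.
  rewrite mulr_sumr; apply: eq_bigr => k _.
  transitivity (Cintegral P setT (fun w => z ^+ k * (N w == k)%:R)).
    by apply: eq_cint => w; rewrite mulrC.
  rewrite cintZ; last first.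
    apply: (@cintegrable_bounded _ _ _ P _ 1) => [|w]; first exact: cmeasurable_bool.
    by case: eqP; rewrite ?cmod1 ?cmod0.
  rewrite -/(Cexpectation P _) Eb /poisson_pmf r0 !rmorphM/= rmorphXn exprMn; ring.
apply: (ccvg_ext (u := fun m => (expR (- r))%:C *
    \sum_(k < m) (k`!%:R^-1)%:C * (r%:C * z) ^+ k)) => [m|]; first by rewrite ES.
have -> : cexp (r%:C * (z - 1)) = (expR (- r))%:C * cexp (r%:C * z).
  rewrite mulrBr mulr1 cexpD mulrC; congr (_ * _).
  by apply: complex_ext; rewrite ?Re_cexp ?Im_cexp /= ?oppr0 ?cos0 ?sin0 ?mulr1 ?mulr0.
by apply: ccvgZ; exact: cexp_series.
Qed.

End poisson_generating_function.
(** * Three consecutive increments of the compound Poisson process *)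

Section compound_poisson.
Context {R : realType} {d} {T : measurableType d} (P : probability T R).
Variables (lambda : R) (t : nat -> T -> R) (a : nat -> T -> nat).
Hypotheses (mt : forall k, measurable_fun setT (t k)) (ma : forall k, measurable_fun setT (a k)).
Hypothesis lambda_gt0 : 0 < lambda.
Hypothesis poisson_t : poisson_points P lambda t.
Hypothesis marking : iid_marking P t a.

Let lf := points_locally_finite poisson_t.

Local Notation g := (mark_pgf P a).

Lemma cmod_mark_pgf_le1 z : cmod z <= 1 -> cmod (g z) <= 1.
Proof.
move=> z1; apply: cmod_Cexpectation_le => [|w]; last exact: cmodX_le1.
exact: (cmeasurable_nat (fun n => z ^+ n) (ma 0)).
Qed.

Lemma mark_pgf1 : g 1 = 1.
Proof.
rewrite -[RHS](Cexpectation_cst P); apply: eq_cint => w.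
by rewrite expr1n.
Qed.

(** The weight that [increments3] gives to a mark placed at time [r]. *)
Definition step3 (s1 s2 s3 : R) (z1 z2 z3 : R[i]) (r : R) : R[i] :=
  if r <= s1 then z1 else if r <= s2 then z2 else if r <= s3 then z3 else 1.

Definition increments3 (A : R -> nat) (s1 s2 s3 : R) (z1 z2 z3 : R[i]) : R[i] :=
  z1 ^+ A s1 * z2 ^+ (A s2 - A s1) * z3 ^+ (A s3 - A s2).

Lemma cmod_increments3_le1 A s1 s2 s3 z1 z2 z3 :
  cmod z1 <= 1 -> cmod z2 <= 1 -> cmod z3 <= 1 ->
  cmod (increments3 A s1 s2 s3 z1 z2 z3) <= 1.
Proof. by move=> h1 h2 h3; rewrite !cmodM_le1 ?cmodX_le1. Qed.

Section fixed_times.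
Variables (s1 s2 s3 : R) (z1 z2 z3 : R[i]).
Hypotheses (s1_ge0 : 0 <= s1) (s12 : s1 <= s2) (s23 : s2 <= s3).
Hypotheses (z1_le1 : cmod z1 <= 1) (z2_le1 : cmod z2 <= 1) (z3_le1 : cmod z3 <= 1).

Let c := step3 s1 s2 s3 z1 z2 z3.

Let c_le1 r : cmod (c r) <= 1.
Proof. by rewrite /c /step3; case: ifP => // _; case: ifP => // _; case: ifP => // _; rewrite cmod1. Qed.

(** A product over the points sorts the marks by interval. Taking all marks equal
    to 1 gives the same identity for the counting process. *)
Lemma prod_step3 (b : nat -> T -> nat) (y1 y2 y3 : R[i]) w N :
  (forall k, t k w <= s3 -> (k < N)%N) ->
  \prod_(k < N) step3 s1 s2 s3 y1 y2 y3 (t k w) ^+ b k w =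
  increments3 (fun s => marked_sum t b s w) s1 s2 s3 y1 y2 y3.
Proof.
move=> HN; have HN2 k : t k w <= s2 -> (k < N)%N by move=> tk; apply: HN; exact: le_trans tk s23.
have HN1 k : t k w <= s1 -> (k < N)%N by move=> tk; apply: HN2; exact: le_trans tk s12.
rewrite /increments3 (marked_sum_trunc b HN1) (marked_sum_trunc b HN2) (marked_sum_trunc b HN).
elim: N {HN HN1 HN2} => [|N IHN]; first by rewrite !big_ord0 !expr0 !mulr1.
have mono (s s' : R) : s <= s' ->
    (\sum_(k < N | (t k w <= s)%R) b k w <= \sum_(k < N | (t k w <= s')%R) b k w)%N.
  move=> ss'; rewrite big_mkcond [leqRHS]big_mkcond; apply: leq_sum => k _.
  by case: ifP => // tk; rewrite (le_trans tk ss').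
have step s : (\sum_(k < N.+1 | (t k w <= s)%R) b k w)%N =
    (\sum_(k < N | (t k w <= s)%R) b k w + if (t N w <= s)%R then b N w else 0)%N.
  by rewrite big_mkcond big_ord_recr/= -big_mkcond.
rewrite big_ord_recr/= IHN !step /step3; set S := fun s => (\sum_(k < N | (t k w <= s)%R) b k w)%N.
have m12 : (S s1 <= S s2)%N := mono _ _ s12.
have m23 : (S s2 <= S s3)%N := mono _ _ s23.
rewrite -/(S s1) -/(S s2) -/(S s3).
have [t1|t1] := leP (t N w) s1.
  by rewrite (le_trans t1 s12) (le_trans t1 (le_trans s12 s23)) !subnDr exprD; ring.
have [t2|t2] := leP (t N w) s2.
  by rewrite (le_trans t2 s23) subnDr addn0 -addnBAC// [y2 ^+ (_ + _)]exprD; ring.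
have [t3|t3] := leP (t N w) s3.
  by rewrite !addn0 -addnBAC// exprD; ring.
by rewrite !addn0 expr1n mulr1.
Qed.

Lemma cmeasurable_increments3 (b : nat -> T -> nat) (y1 y2 y3 : R[i]) :
  (forall k, measurable_fun setT (b k)) ->
  cmeasurable (fun w => increments3 (fun s => marked_sum t b s w) s1 s2 s3 y1 y2 y3).
Proof.
move=> mb; have mS s : measurable_fun setT (marked_sum t b s) by exact: measurable_marked_sum.
apply: cmeasurableM; first apply: cmeasurableM.
- exact: (cmeasurable_nat (fun n => y1 ^+ n) (mS s1)).
- exact: (cmeasurable_nat (fun n => y2 ^+ n) (measurable_nat2 subn (mS s2) (mS s1))).
- exact: (cmeasurable_nat (fun n => y3 ^+ n) (measurable_nat2 subn (mS s3) (mS s2))).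
Qed.

Let mle {d'} {V : measurableType d'} (r : V -> R) (s : R) : measurable_fun setT r ->
  measurable_fun setT (fun w => r w <= s).
Proof. by move=> mr; apply: measurable_fun_ler => //; exact: measurable_cst. Qed.

Lemma cmeasurable_step3 {d'} {V : measurableType d'} (r : V -> R) (n : V -> nat) (y1 y2 y3 : R[i]) :
  measurable_fun setT r -> measurable_fun setT n ->
  cmeasurable (fun v => step3 s1 s2 s3 y1 y2 y3 (r v) ^+ n v).
Proof.
move=> mr mn; apply: (cmeasurable_ext (f := fun v =>
  if r v <= s1 then y1 ^+ n v else if r v <= s2 then y2 ^+ n v
  else if r v <= s3 then y3 ^+ n v else 1)) => [v|].
  by rewrite /step3; case: ifP => // _; case: ifP => // _; case: ifP => //; rewrite expr1n.
have mpow y : cmeasurable (fun v => y ^+ n v) by exact: (cmeasurable_nat (fun n => y ^+ n) mn).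
by do 3 (apply: cmeasurable_if => //; first exact: mle); exact: cmeasurable_cst.
Qed.

(** Given the points, the marks are i.i.d. and each mark contributes its
    generating function at the weight of its point. *)
Lemma expectation_marks_out N :
  Cexpectation P (fun w => \prod_(k < N) c (t k w) ^+ a k w) =
  Cexpectation P (fun w => \prod_(k < N) g (c (t k w))).
Proof.
have m1 := sigma_of_measurable (fun i (_ : setT i) => ma i).
have m2 := sigma_of_measurable (fun i (_ : setT i) => mt i).
pose F w1 w2 := \prod_(k < N) c (t k w2) ^+ a k w1.
have mF : cmeasurable (fun p : g_sigma_algebraType (generators setT a) *
    g_sigma_algebraType (generators setT t) => F p.1 p.2).
  apply: cmeasurable_prod => k; apply: cmeasurable_step3.
    by apply: (measurableT_comp _ measurable_snd); exact: measurable_generators.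
  by apply: (measurableT_comp _ measurable_fst); exact: measurable_generators.
have F1 w1 w2 : cmod (F w1 w2) <= 1.
  rewrite /F; elim/big_ind: _ => [|x y|k _]; rewrite ?cmod1//; first exact: cmodM_le1.
  exact: cmodX_le1.
rewrite [LHS](independent_freeze m1 m2 (marks_points_indep marking) mF F1).
apply: eq_cint => w2; rewrite (expectation_prod_independent ma (marks_indep marking)
    (f := fun k n => c (t k w2) ^+ n)) => [|k|k n].
- apply: eq_bigr => k _; apply: (same_law_Cexpectation (f := fun n => c (t k w2) ^+ n) (k := 1)) => //.
  + exact: (marks_same_law marking).
  + by move=> n; exact: cmodX_le1.
- exact: (cmeasurable_nat (fun n => c (t k w2) ^+ n) (@measurable_id _ nat setT)).
- exact: cmodX_le1.
Qed.

(** Both sides are limits of products over the first [N] points, for which the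
    marks have been integrated out. *)
Lemma increments3_points :
  Cexpectation P (fun w => increments3 (fun s => marked_sum t a s w) s1 s2 s3 z1 z2 z3) =
  Cexpectation P (fun w => increments3 (fun s => npoints t s w) s1 s2 s3 (g z1) (g z2) (g z3)).
Proof.
have i1 := finite_measure_integrable_cst P (1 : R) measurableT.
have prod1 (F : nat -> T -> R[i]) N w : (forall k, cmod (F k w) <= 1) ->
    cmod (\prod_(k < N) F k w) <= 1.
  by move=> F1; elim/big_ind: _ => [|x y|k _]; rewrite ?cmod1//; exact: cmodM_le1.
have C1 : ccvg (fun N => Cexpectation P (fun w => \prod_(k < N) c (t k w) ^+ a k w))
    (Cexpectation P (fun w => increments3 (fun s => marked_sum t a s w) s1 s2 s3 z1 z2 z3)).
  apply: (cdominated_convergence _ _ i1) => [N||N w|w].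
  - by apply: cmeasurable_prod => k; apply: cmeasurable_step3.
  - exact: cmeasurable_increments3.
  - by apply: (prod1 (fun k w => c (t k w) ^+ a k w)) => k; exact: cmodX_le1.
  have [N HN] := points_bound lf s3 w.
  apply: (@ccvg_eventually _ _ _ N) => n Nn; apply: prod_step3 => k /HN kN.
  exact: leq_trans kN Nn.
have cg r : g (c r) = step3 s1 s2 s3 (g z1) (g z2) (g z3) r.
  by rewrite /c /step3; do 3 (case: ifP => // _); exact: mark_pgf1.
have C2 : ccvg (fun N => Cexpectation P (fun w => \prod_(k < N) g (c (t k w))))
    (Cexpectation P (fun w => increments3 (fun s => npoints t s w) s1 s2 s3 (g z1) (g z2) (g z3))).
  apply: (cdominated_convergence _ _ i1) => [N||N w|w].
  - apply: cmeasurable_prod => k.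
    apply: cmeasurable_ext (cmeasurable_step3 (g z1) (g z2) (g z3) (mt k) (measurable_cst 1%N)) => w.
    by rewrite cg expr1.
  - by apply: cmeasurable_increments3 => k; exact: measurable_cst.
  - apply: (prod1 (fun k w => g (c (t k w)))) => k; exact: cmod_mark_pgf_le1.
  have [N HN] := points_bound lf s3 w.
  apply: (@ccvg_eventually _ _ _ N) => n Nn.
  have HN' k : t k w <= s3 -> (k < n)%N by move=> /HN kN; exact: leq_trans kN Nn.
  apply: etrans (prod_step3 (fun _ _ => 1%N) (g z1) (g z2) (g z3) HN').
  by apply: eq_bigr => k _; rewrite cg expr1.
apply: (ccvg_unique C1); apply: ccvg_ext C2 => N.
by rewrite -expectation_marks_out.
Qed.

Lemma npoints_pgf s s' z : 0 <= s -> s <= s' -> cmod z <= 1 ->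
  Cexpectation P (fun w => z ^+ (npoints t s' w - npoints t s w)) =
  cexp ((lambda * (s' - s))%:C * (z - 1)).
Proof.
move=> s0; rewrite le_eqVlt => /predU1P[->|ss'] zle1.
  rewrite subrr mulr0 mul0r cexp0 -[RHS](Cexpectation_cst P).
  by apply: eq_cint => w; rewrite subnn.
have mN r : measurable_fun setT (npoints t r) by apply: measurable_marked_sum => //.
apply: poisson_pgf => //; first exact: (measurable_nat2 subn).
- by rewrite mulr_gt0// subr_gt0.
- by move=> k; exact: (npoints_poisson poisson_t).
Qed.

(** After the marks have been integrated out, the counts on the three intervals
    are independent Poisson variables. The first count is an increment from time
    0, where the counting process vanishes almost surely. *)
Lemma expectation_increments3 :
  Cexpectation P (fun w => increments3 (fun s => marked_sum t a s w) s1 s2 s3 z1 z2 z3) =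
  cexp ((lambda * s1)%:C * (g z1 - 1)) * cexp ((lambda * (s2 - s1))%:C * (g z2 - 1))
  * cexp ((lambda * (s3 - s2))%:C * (g z3 - 1)).
Proof.
rewrite increments3_points.
pose s (n : nat) : R := match n with 0 => 0 | 1 => s1 | 2 => s2 | _ => s3 end.
have mN r : measurable_fun setT (npoints t r) by apply: measurable_marked_sum => //.
pose X n w := (npoints t (s n.+1) w - npoints t (s n) w)%N.
have mX n : measurable_fun setT (X n) by exact: (measurable_nat2 subn).
have indX : mutually_independent P X.
  by apply: (npoints_indep poisson_t) => // -[|[|[|n]]] /=.
pose y (n : nat) := match n with 0 => g z1 | 1 => g z2 | _ => g z3 end.
have y1 n : cmod (y n) <= 1 by case: n => [|[|n]]; exact: cmod_mark_pgf_le1.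
have mpow i : cmeasurable (fun n : nat => y i ^+ n) by split.
have := expectation_prod_independent mX indX mpow (fun i k => cmodX_le1 k (y1 i)) 3.
have EX n : Cexpectation P (fun w => y n ^+ X n w) =
    cexp ((lambda * (s n.+1 - s n))%:C * (y n - 1)).
  have s2_ge0 := le_trans s1_ge0 s12; have s3_ge0 := le_trans s2_ge0 s23.
  by apply: npoints_pgf => //; case: n => [|[|[|n]]] /=.
rewrite [RHS](eq_bigr _ (fun i _ => EX (nat_of_ord i))) => E3.
have -> : cexp ((lambda * s1)%:C * (g z1 - 1)) * cexp ((lambda * (s2 - s1))%:C * (g z2 - 1))
    * cexp ((lambda * (s3 - s2))%:C * (g z3 - 1)) =
  \prod_(i < 3) cexp ((lambda * (s i.+1 - s i))%:C * (y i - 1)).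
  by rewrite !big_ord_recr big_ord0 /= mul1r subr0.
rewrite -E3.
apply: ae_eq_cint.
- by apply: cmeasurable_increments3 => k; exact: measurable_cst.
- apply: cmeasurable_prod => i.
  exact: (cmeasurable_nat (fun n => y i ^+ n) (mX i)).
have N0 : {ae P, forall w, npoints t 0 w = 0%N}.
  exists (~` [set w | npoints t 0 w = 0%N]); split => //.
    by apply: measurableC; exact: measurable_nat_fiber.
  rewrite probability_setC; last exact: measurable_nat_fiber.
  by rewrite [X in (_ - X)%E](npoints0 poisson_t) subee.
apply: filterS N0 => w N0w.
by rewrite !big_ord_recr big_ord0 /= mul1r /X /= N0w subn0.
Qed.

End fixed_times.

End compound_poisson.
(** * Increments between random times independent of the process *)

Section random_times.
Context {R : realType} {d} {T : measurableType d} (P : probability T R).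
Variables (lambda : R) (t : nat -> T -> R) (a : nat -> T -> nat) (tau : nat -> T -> R).
Hypotheses (mt : forall k, measurable_fun setT (t k)) (ma : forall k, measurable_fun setT (a k)).
Hypothesis mtau : forall n, measurable_fun setT (tau n).
Hypothesis lambda_gt0 : 0 < lambda.
Hypothesis poisson_t : poisson_points P lambda t.
Hypothesis marking : iid_marking P t a.

Local Notation A := (marked_sum t a).
Local Notation g := (mark_pgf P a).

Hypothesis A_tau : independent_sigma P (sigma_of [set s : R | 0 <= s] A) (sigma_of setT tau).

Local Notation TA := (g_sigma_algebraType (generators [set s : R | 0 <= s] A)).
Local Notation Ttau := (g_sigma_algebraType (generators setT tau)).

Let lf := points_locally_finite poisson_t.

(** Independence freezes the observation times, and the formula for fixed times
    applies to each of their values. *)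
Lemma expectation_random_increments (S1 S2 S3 : T -> R) (h : T -> R[i]) (k : R) z1 z2 z3 :
  measurable_fun setT (S1 : Ttau -> R) -> measurable_fun setT (S2 : Ttau -> R) ->
  measurable_fun setT (S3 : Ttau -> R) -> cmeasurable (h : Ttau -> R[i]) ->
  (forall w, 0 <= S1 w) -> (forall w, S1 w <= S2 w) -> (forall w, S2 w <= S3 w) ->
  (forall w, cmod (h w) <= k) -> cmod z1 <= 1 -> cmod z2 <= 1 -> cmod z3 <= 1 ->
  Cexpectation P (fun w =>
    h w * increments3 (fun s => A s w) (S1 w) (S2 w) (S3 w) z1 z2 z3) =
  Cexpectation P (fun w => h w *
    (cexp ((lambda * S1 w)%:C * (g z1 - 1)) * cexp ((lambda * (S2 w - S1 w))%:C * (g z2 - 1))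
     * cexp ((lambda * (S3 w - S2 w))%:C * (g z3 - 1)))).
Proof.
move=> m1 m2 m3 mh S10 S12 S23 hk z1le z2le z3le.
have S20 w : 0 <= S2 w := le_trans (S10 w) (S12 w).
have S30 w : 0 <= S3 w := le_trans (S20 w) (S23 w).
have mA s : measurable_fun setT (A s) by exact: measurable_marked_sum.
have mG1 := sigma_of_measurable (fun s (_ : [set s : R | 0 <= s] s) => mA s).
have mG2 := sigma_of_measurable (fun i (_ : setT i) => mtau i).
pose F w1 w2 := h w2 * increments3 (fun s => A s w1) (S1 w2) (S2 w2) (S3 w2) z1 z2 z3.
have mS (S : T -> R) : measurable_fun setT (S : Ttau -> R) -> (forall w, 0 <= S w) ->
    measurable_fun setT (fun p : TA * Ttau => A (S p.2) p.1).
  move=> mS S0; apply: (@measurable_right_continuous_sampling R _ _ _ TA A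
    (fun p : TA * Ttau => S p.2) fst).
  - by move=> s s0; exact: measurable_generators.
  - by move=> s w _; exact: marked_sum_right_continuous.
  - exact: (measurableT_comp mS measurable_snd).
  - by move=> p; exact: S0.
  - exact: measurable_fst.
have mF : cmeasurable (fun p : TA * Ttau => F p.1 p.2).
  apply: cmeasurableM; first exact: (cmeasurable_comp measurable_snd mh).
  apply: cmeasurableM; first apply: cmeasurableM.
  - exact: (cmeasurable_nat (fun n => z1 ^+ n) (mS _ m1 S10)).
  - exact: (cmeasurable_nat (fun n => z2 ^+ n) (measurable_nat2 subn (mS _ m2 S20) (mS _ m1 S10))).
  - exact: (cmeasurable_nat (fun n => z3 ^+ n) (measurable_nat2 subn (mS _ m3 S30) (mS _ m2 S20))).
have Fk w1 w2 : cmod (F w1 w2) <= k.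
  rewrite /F cmodM (le_trans _ (hk w2))// ler_piMr ?cmod_ge0//.
  exact: cmod_increments3_le1.
rewrite [LHS](independent_freeze mG1 mG2 A_tau mF Fk).
apply: eq_cint => w2; rewrite /F [LHS]cintZ.
  by congr (_ * _); exact: expectation_increments3.
apply: (@cintegrable_bounded _ _ _ P _ 1); last by move=> w1; exact: cmod_increments3_le1.
by apply: (cmeasurable_increments3 _ poisson_t).
Qed.

End random_times.
(** * Integration in time *)

Section time_integrals.
Context {R : realType}.
Local Notation mu := (@lebesgue_measure R).

Lemma Rintegral_itv_derive (F f : R -> R) (a b : R) : a <= b ->
  (forall s : R, is_derive s 1 F (f s)) -> continuous f ->
  \int[mu]_s ((a <= s < b)%R%:R * f s) = F b - F a.
Proof.
move=> ab Ff cf.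
have cF : continuous F.
  move=> s; apply: differentiable_continuous; apply/derivable1_diffP.
  by have [] := Ff s.
have mf : measurable_fun setT f by exact: continuous_measurable_fun.
have fi : mu.-integrable `[a, b] (EFin \o f).
  apply: continuous_compact_integrable; first exact: segment_compact.
  exact: continuous_subspaceT.
have -> : \int[mu]_s ((a <= s < b)%R%:R * f s) = \int[mu]_(s in `[a, b[) f s.
  rewrite [RHS]Rintegral_mkcond; apply: eq_Rintegral => s _.
  by rewrite patchE; case: ifPn => [|/negbTE]; rewrite mem_setE in_itv/= => ->;
    rewrite ?mul1r ?mul0r.
rewrite Rintegral_itv_bndo_bndc; last first.
  by apply: integrableS fi => //; apply: subset_itvl; rewrite bnd_simp.
have [ab'|ab'] := ltP a b; last first.
  have -> : b = a by apply/le_anti/andP.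
  by rewrite set_itv1 Rintegral_set1 subrr.
rewrite /Rintegral (continuous_FTC2 (F := F)) //.
- exact: continuous_subspaceT.
- split.
  + by move=> s _; have [] := Ff s.
  + by apply: cvg_at_right_filter; exact: cF.
  + by apply: cvg_at_left_filter; exact: cF.
- by move=> s _; rewrite derive1E derive_val.
Qed.

Lemma cint_itv_cderive (G G1 G2 : R -> R[i]) (a b : R) : a <= b ->
  (forall s, is_cderive G s (G1 s)) -> (forall s, is_cderive G1 s (G2 s)) ->
  Cintegral mu setT (fun s => (a <= s < b)%R%:R * G1 s) = G b - G a.
Proof.
move=> ab GG1 G1G2.
have cont (p : R[i] -> R) : (forall s : R, is_derive s 1 (fun r => p (G1 r)) (p (G2 s))) ->
    continuous (fun r => p (G1 r)).
  move=> pd s; apply: differentiable_continuous; apply/derivable1_diffP.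
  by have [] := pd s.
have RR (k : bool) : k%:R = (k%:R : R)%:C :> R[i] by rewrite rmorph_nat.
apply: complex_ext => /=.
- rewrite cReD cReN -(Rintegral_itv_derive ab (fun s => (GG1 s).1)); last first.
    by apply: (cont (fun z => Re z)) => s; case: (G1G2 s).
  by apply: eq_Rintegral => s _; rewrite RR cReM/= mul0r subr0.
- rewrite cImD cImN -(Rintegral_itv_derive ab (fun s => (GG1 s).2)); last first.
    by apply: (cont (fun z => Im z)) => s; case: (G1G2 s).
  by apply: eq_Rintegral => s _; rewrite RR cImM/= mul0r addr0.
Qed.

Lemma cint_itv_cexp (rho c : R[i]) (a b : R) : a <= b -> rho != 0 ->
  Cintegral mu setT (fun s => (a <= s < b)%R%:R * (c * cexp (- rho * s%:C))) =
  c * (cexp (- rho * a%:C) - cexp (- rho * b%:C)) / rho.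
Proof.
move=> ab rho0.
rewrite (cint_itv_cderive (G := fun s => - (c / rho) * cexp (- rho * s%:C))
   (G2 := fun s => c * (- rho * cexp (- rho * s%:C))) ab).
- by ring.
- move=> s; have := is_cderiveZ (- (c / rho)) (is_cderive_cexp (- rho) s).
  by rewrite mulrA mulrNN divfK.
- by move=> s; apply: is_cderiveZ; exact: is_cderive_cexp.
Qed.

(** This is exp (- r s) for s >= 0 and 0 for s < 0; through the exponential
    density its integrability is a statement about a probability law. *)
Definition damping (r s : R) : R := r^-1 * exponential_pdf r s.

Lemma integrable_damping r : 0 < r -> mu.-integrable setT (EFin \o damping r).
Proof.
move=> r0; have mp := measurable_exponential_pdf (R := R) r.
have pi : mu.-integrable setT (EFin \o exponential_pdf r).
  apply/integrableP; split; first exact/measurable_EFinP.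
  apply: (@le_lt_trans _ _ 1%E); last exact: ltry.
  rewrite -(integral_exponential_pdf r0) le_eqVlt; apply/orP; left; apply/eqP.
  by apply: eq_integral => s _ /=; rewrite ger0_norm// exponential_pdf_ge0// ltW.
by apply: eq_integrable (integrableZl _ r^-1 pi) => // s _ /=; rewrite EFinM.
Qed.

Lemma damping_ge0 r s : 0 < r -> 0 <= damping r s.
Proof. by move=> r0; rewrite mulr_ge0 ?invr_ge0 ?exponential_pdf_ge0// ltW. Qed.

Lemma dampingE r s : 0 < r -> 0 <= s -> damping r s = expR (- r * s).
Proof. by move=> r0 s0; rewrite /damping exponential_pdfE// mulKf// gt_eqF. Qed.

Lemma cmod_cexp_damping (theta : R[i]) s : 0 < Re theta -> 0 <= s ->
  cmod (cexp (- theta * s%:C)) = damping (Re theta) s.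
Proof. by move=> t0 s0; rewrite cmod_cexp cReMr cReN dampingE. Qed.

End time_integrals.
(** * The observed process *)

Section observed.
Context {R : realType} {d} {T : measurableType d} (P : probability T R).
Variables (lambda : R) (t : nat -> T -> R) (a : nat -> T -> nat) (tau : nat -> T -> R).
Hypotheses (mt : forall k, measurable_fun setT (t k)) (ma : forall k, measurable_fun setT (a k)).
Hypothesis mtau : forall n, measurable_fun setT (tau n).
Hypothesis lambda_gt0 : 0 < lambda.
Hypothesis poisson_t : poisson_points P lambda t.
Hypothesis marking : iid_marking P t a.
Hypothesis renewal : delayed_renewal P tau.

Local Notation A := (marked_sum t a).
Local Notation g := (mark_pgf P a).
Local Notation mu := (@lebesgue_measure R).

Hypothesis A_tau : independent_sigma P (sigma_of [set s : R | 0 <= s] A) (sigma_of setT tau).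

Local Notation Ttau := (g_sigma_algebraType (generators setT tau)).

Let lf := points_locally_finite poisson_t.

Lemma before_le n w : before tau n w <= tau n w.
Proof. by rewrite -subr_ge0; exact: (gaps_ge0 renewal). Qed.

Lemma tau_ge0 n w : 0 <= tau n w.
Proof.
elim: n => [|n IHn]; first by have := before_le 0 w.
exact: le_trans IHn (before_le n.+1 w).
Qed.

Lemma before_ge0 n w : 0 <= before tau n w.
Proof. by case: n => [|n] //=; exact: tau_ge0. Qed.

Lemma tau_mono n m w : (n <= m)%N -> tau n w <= tau m w.
Proof.
elim: m => [|m IHm]; first by rewrite leqn0 => /eqP->.
rewrite leq_eqVlt => /predU1P[->//|/IHm h]; exact: le_trans h (before_le m.+1 w).
Qed.

Lemma before_sum_gaps n w : before tau n w = \sum_(j < n) gap tau j w.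
Proof.
elim: n => [|n IHn]; first by rewrite big_ord0.
by rewrite big_ord_recr/= -IHn /gap addrC subrK.
Qed.

Let mgen n : measurable_fun setT (tau n : Ttau -> R).
Proof. exact: measurable_generators. Qed.

Let mgen_before n : measurable_fun setT (before tau n : Ttau -> R).
Proof. by case: n => [|n] /=; [exact: measurable_cst|exact: mgen]. Qed.

Let mgen_gap n : measurable_fun setT (gap tau n : Ttau -> R).
Proof. exact: measurable_funB. Qed.

Let mbefore n : measurable_fun setT (before tau n).
Proof. by case: n => [|n] /=; [exact: measurable_cst|exact: mtau]. Qed.

Let mgap n : measurable_fun setT (gap tau n).
Proof. exact: measurable_funB. Qed.

Let mA s : measurable_fun setT (A s).
Proof. exact: measurable_marked_sum. Qed.

Let mA_sampled d' (W : measurableType d') (S : W -> R) (X : W -> T) :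
  measurable_fun setT S -> (forall w, 0 <= S w) -> measurable_fun setT X ->
  measurable_fun setT (fun w => A (S w) (X w)).
Proof.
apply: (@measurable_right_continuous_sampling R _ _ W T A) => [s _|s w _]; first exact: mA.
exact: marked_sum_right_continuous.
Qed.

Lemma measurable_obs n : measurable_fun setT (obs A tau n).
Proof. by apply: (mA_sampled (S := tau n) (X := id)) => // w; exact: tau_ge0. Qed.

Lemma measurable_obs_before n : measurable_fun setT (obs_before A tau n).
Proof. by case: n => [|n] /=; [exact: measurable_cst|exact: measurable_obs]. Qed.

Lemma marked_sum0_ae : {ae P, forall w, A 0 w = 0%N}.
Proof.
exists (~` [set w | npoints t 0 w = 0%N]).
have mN : measurable [set w | npoints t 0 w = 0%N].
  by apply: measurable_nat_fiber; exact: measurable_marked_sum.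
split; first exact: measurableC.
  by rewrite probability_setC// [X in (_ - X)%E](npoints0 poisson_t) subee.
apply: subsetC => w /= N0; have [N HN] := points_bound lf 0 w.
rewrite (marked_sum_trunc a HN) big1// => k tk0.
move: N0; rewrite /npoints (marked_sum_trunc (fun _ _ => 1%N) HN) => /eqP.
by rewrite sum_nat_eq0 => /forallP/(_ k); rewrite tk0.
Qed.

Lemma obs_before_ae n : {ae P, forall w, obs_before A tau n w = A (before tau n w) w}.
Proof.
case: n => [|n] /=; last exact: aeW.
by apply: filterS marked_sum0_ae => w ->.
Qed.

(** ** The gap transforms *)

(** A gap of length [s] costs its Laplace factor together with the generating
    function of the increment of the process over a time [s]. *)
Definition gap_weight (z theta : R[i]) (s : R) : R[i] :=
  cexp (- (theta + lambda%:C * (1 - g z)) * s%:C).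

Lemma gap_weightD z theta s s' :
  gap_weight z theta (s + s') = gap_weight z theta s * gap_weight z theta s'.
Proof. by rewrite /gap_weight rmorphD mulrDr cexpD. Qed.

Lemma Re_rate_ge0 z theta : cmod z <= 1 -> 0 <= Re theta ->
  Re theta <= Re (theta + lambda%:C * (1 - g z)).
Proof.
move=> z1 t0; rewrite cReD cReMl lerDl mulr_ge0 ?(ltW lambda_gt0)//.
rewrite cReD cReN subr_ge0 (le_trans (ler_norm _))// (le_trans (cmod_Re _))//.
exact: cmod_mark_pgf_le1.
Qed.

Lemma cmod_gap_weight_le z theta s : cmod z <= 1 -> 0 <= Re theta -> 0 <= s ->
  cmod (gap_weight z theta s) <= expR (- Re theta * s).
Proof.
move=> z1 t0 s0; rewrite cmod_cexp cReMr ler_expR ler_wpM2r// cReN lerN2.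
exact: Re_rate_ge0.
Qed.

Lemma cmod_gap_weight_le1 z theta s : cmod z <= 1 -> 0 <= Re theta -> 0 <= s ->
  cmod (gap_weight z theta s) <= 1.
Proof.
move=> z1 t0 s0; apply: le_trans (cmod_gap_weight_le z1 t0 s0) _.
by rewrite -(expR0 R) ler_expR mulNr oppr_le0 mulr_ge0.
Qed.

Lemma cmeasurable_gap_weight {d'} {V : measurableType d'} z theta (s : V -> R) :
  measurable_fun setT s -> cmeasurable (fun w => gap_weight z theta (s w)).
Proof.
move=> ms; apply: cmeasurable_cexp; apply: cmeasurableM; first exact: cmeasurable_cst.
exact: cmeasurable_real.
Qed.

Lemma gamma_atE n z theta : cmod z <= 1 -> 0 <= Re theta ->
  gamma_at P A tau n z theta = Cexpectation P (fun w => gap_weight z theta (gap tau n w)).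
Proof.
move=> z1 t0.
have h1 w : cmod (cexp (- theta * (gap tau n w)%:C)) <= 1.
  by apply: cmod_cexp_le1; rewrite cReMr cReN mulNr oppr_le0 mulr_ge0// (gaps_ge0 renewal).
have c1 : cmod (1 : R[i]) <= 1 by rewrite cmod1.
have mh d' (V : measurableType d') (s : V -> R) : measurable_fun setT s ->
    cmeasurable (fun w => cexp (- theta * (s w)%:C)).
  move=> ms; apply: cmeasurable_cexp; apply: cmeasurableM; first exact: cmeasurable_cst.
  exact: cmeasurable_real.
have := expectation_random_increments mt ma mtau lambda_gt0 poisson_t marking A_tau
  (mgen_before n) (mgen n) (mgen n) (mh _ _ _ (mgen_gap n)) (before_ge0 n) (before_le n)
  (fun w => lexx _) h1 c1 z1 c1.
move=> E; rewrite /gamma_at.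
transitivity (Cexpectation P (fun w => cexp (- theta * (gap tau n w)%:C) *
    increments3 (fun s => A s w) (before tau n w) (tau n w) (tau n w) 1 z 1)).
  apply: ae_eq_cint.
  - apply: cmeasurableM; last exact: mh.
    exact: (cmeasurable_nat (fun k => z ^+ k)
      (measurable_nat2 subn (measurable_obs n) (measurable_obs_before n))).
  - apply: cmeasurableM; first exact: mh.
    have mB : measurable_fun setT (fun w => A (before tau n w) w).
      exact: (mA_sampled (mbefore n) (before_ge0 n) (@measurable_id _ T setT)).
    apply: cmeasurableM; first apply: cmeasurableM.
    + exact: (cmeasurable_nat (fun k => 1 ^+ k) mB).
    + exact: (cmeasurable_nat (fun k => z ^+ k) (measurable_nat2 subn (measurable_obs n) mB)).
    + exact: (cmeasurable_nat (fun k => 1 ^+ k)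
        (measurable_nat2 subn (measurable_obs n) (measurable_obs n))).
  apply: filterS (obs_before_ae n) => w Hw.
  by rewrite /increments3 /obs_incr Hw !expr1n mul1r mulr1 mulrC.
rewrite E; apply: eq_cint => w.
rewrite mark_pgf1 !subrr !mulr0 cexp0 mul1r mulr1 -cexpD /gap_weight; congr cexp.
by rewrite -/(gap tau n w) rmorphM/=; ring.
Qed.

(** A negative argument could make [gap_weight] unbounded, hence the absolute
   values, which do not change a gap. *)
Lemma gamma_at_renewal n z theta : cmod z <= 1 -> 0 <= Re theta ->
  gamma_at P A tau n.+1 z theta = gamma_at P A tau 1 z theta.
Proof.
move=> z1 t0; rewrite !gamma_atE//.
transitivity (Cexpectation P (fun w => gap_weight z theta `|gap tau n.+1 w|)).
  by apply: eq_cint => w; rewrite ger0_norm// (gaps_ge0 renewal).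
transitivity (Cexpectation P (fun w => gap_weight z theta `|gap tau 1 w|)).
  apply: (same_law_Cexpectation (X := gap tau n.+1) (Y := gap tau 1)
    (f := fun s : R => gap_weight z theta `|s|) (k := 1)) => //.
  - exact: (gaps_same_law renewal).
  - by apply: cmeasurable_gap_weight; exact: normr_measurable.
  - by move=> s; exact: cmod_gap_weight_le1.
by apply: eq_cint => w; rewrite ger0_norm// (gaps_ge0 renewal).
Qed.

(** The time before the n-th gap is the sum of the earlier gaps, and the weight is
    multiplicative in time. *)
Lemma expectation_gap_weights n z theta z' theta' : cmod z <= 1 -> 0 <= Re theta ->
  cmod z' <= 1 -> 0 <= Re theta' ->
  Cexpectation P (fun w =>
    gap_weight z theta (before tau n w) * gap_weight z' theta' (gap tau n w)) =
  (\prod_(j < n) gamma_at P A tau j z theta) * gamma_at P A tau n z' theta'.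
Proof.
move=> z1 t0 z1' t0'.
(* The absolute value makes the weights bounded on the whole line. *)
pose f j (s : R) := if (j < n)%N then gap_weight z theta `|s| else gap_weight z' theta' `|s|.
have mn (r : R[i]) th : cmeasurable (fun s : R => gap_weight r th `|s|).
  by apply: cmeasurable_gap_weight; exact: normr_measurable.
have mf j : cmeasurable (f j) by rewrite /f; case: (j < n)%N; exact: mn.
have f1 j s : cmod (f j s) <= 1 by rewrite /f; case: ifP => _; exact: cmod_gap_weight_le1.
have fE j : Cexpectation P (fun w => f j (gap tau j w)) =
    if (j < n)%N then gamma_at P A tau j z theta else gamma_at P A tau j z' theta'.
  by rewrite /f; case: (j < n)%N; rewrite gamma_atE//; apply: eq_cint => w;
    rewrite ger0_norm// (gaps_ge0 renewal).
have := expectation_prod_independent mgap (gaps_indep renewal) mf f1 n.+1.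
rewrite [RHS](eq_bigr _ (fun j _ => fE (nat_of_ord j))) [RHS]big_ord_recr/= ltnn.
rewrite (eq_bigr (fun j : 'I_n => gamma_at P A tau j z theta)) => [<-|j _]; last by rewrite ltn_ord.
apply: eq_cint => w.
have H m : (m <= n)%N -> \prod_(i < m) f i (gap tau i w) =
    gap_weight z theta (\sum_(j < m) gap tau j w).
  elim: m => [|m IHm] mn'; first by rewrite !big_ord0 /gap_weight mulr0 cexp0.
  rewrite !big_ord_recr/= gap_weightD IHm ?(ltnW mn')//; congr (_ * _).
  by rewrite /f mn' ger0_norm// (gaps_ge0 renewal).
rewrite before_sum_gaps -H// big_ord_recr/=; congr (_ * _).
by rewrite /f ltnn ger0_norm// (gaps_ge0 renewal).
Qed.

(** ** One observation interval *)

(** The value of the functional on the event that the interval of index [n]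
    contains [s]. *)
Definition slice n (u v wt x y : R[i]) (s : R) (w : T) : R[i] :=
  u ^+ obs_before A tau n w * v ^+ obs A tau n w
  * cexp (- wt * (before tau n w)%:C - x * (gap tau n w)%:C)
  * y ^+ A s w * (before tau n w <= s < tau n w)%R%:R.

Section slice.
Variables (n : nat) (u v wt x y theta : R[i]).
Hypotheses (u1 : cmod u <= 1) (v1 : cmod v <= 1) (y1 : cmod y <= 1).
Hypotheses (wt0 : 0 <= Re wt) (x0 : 0 <= Re x) (theta0 : 0 < Re theta).

Local Notation b := (before tau n).
Local Notation c := (tau n).

Let delay_le1 w : cmod (cexp (- wt * (b w)%:C - x * (gap tau n w)%:C)) <= 1.
Proof.
apply: cmod_cexp_le1; rewrite cReD cReMr -mulNr cReMr !cReN !mulNr -opprD oppr_le0.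
by rewrite addr_ge0// mulr_ge0// ?before_ge0// (gaps_ge0 renewal).
Qed.

Lemma cmod_slice_le s w :
  cmod (cexp (- theta * s%:C) * slice n u v wt x y s w) <= damping (Re theta) s.
Proof.
rewrite /slice; have [/andP[bs _]|_] := boolP (b w <= s < c w); last first.
  by rewrite mulr0 mulr0 cmod0 damping_ge0.
have s0 : 0 <= s := le_trans (before_ge0 n w) bs.
rewrite mulr1 cmodM cmod_cexp_damping// ler_piMr ?damping_ge0//.
by do 3 (apply: cmodM_le1; last exact: cmodX_le1 || exact: delay_le1); exact: cmodX_le1.
Qed.

Let mfst : measurable_fun setT (fst : measurableTypeR R * T -> R).
Proof. exact: measurable_fst. Qed.

Let msnd : measurable_fun setT (snd : measurableTypeR R * T -> T).
Proof. exact: measurable_snd. Qed.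

Let mmax : measurable_fun setT (fun p : measurableTypeR R * T => Num.max p.1 0).
Proof. by apply: measurable_maxr => //; exact: measurable_cst. Qed.

Let mAmax : measurable_fun setT (fun p : measurableTypeR R * T => A (Num.max p.1 0) p.2).
Proof. by apply: mA_sampled => // p; rewrite le_max lexx orbT. Qed.

Let mind : measurable_fun setT (fun p : measurableTypeR R * T => b p.2 <= p.1 < c p.2).
Proof.
apply: measurable_and.
  by apply: measurable_fun_ler => //; exact: (measurableT_comp (mbefore n) msnd).
by apply: measurable_fun_ltr => //; exact: (measurableT_comp (mtau n) msnd).
Qed.

Let mdelay : cmeasurable (fun w => cexp (- wt * (b w)%:C - x * (gap tau n w)%:C)).
Proof.
apply: cmeasurable_cexp; apply: cmeasurableB; apply: cmeasurableM;
  try exact: cmeasurable_cst; apply: cmeasurable_real; [exact: mbefore|exact: mgap].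
Qed.

Lemma cmeasurable_damping : cmeasurable (fun s : measurableTypeR R => cexp (- theta * s%:C)).
Proof.
apply: cmeasurable_cexp; apply: cmeasurableM; first exact: cmeasurable_cst.
by apply: cmeasurable_real; exact: measurable_id.
Qed.

Lemma cmeasurable_slice :
  cmeasurable (fun p : measurableTypeR R * T => slice n u v wt x y p.1 p.2).
Proof.
apply: (cmeasurable_ext (f := fun p : measurableTypeR R * T =>
  u ^+ obs_before A tau n p.2 * v ^+ obs A tau n p.2
  * cexp (- wt * (b p.2)%:C - x * (gap tau n p.2)%:C)
  * y ^+ A (Num.max p.1 0) p.2 * (b p.2 <= p.1 < c p.2)%R%:R)) => [[s w]|].
  rewrite /slice /=; have [/andP[bs _]|_] := boolP (b w <= s < c w); last by rewrite !mulr0.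
  by rewrite (max_idPl (le_trans (before_ge0 n w) bs)).
apply: cmeasurableM; last exact: cmeasurable_bool.
apply: cmeasurableM; last exact: (cmeasurable_nat (fun k => y ^+ k) mAmax).
apply: cmeasurableM; last exact: (cmeasurable_comp msnd mdelay).
apply: cmeasurableM.
  exact: (cmeasurable_nat (fun k => u ^+ k) (measurableT_comp (measurable_obs_before n) msnd)).
exact: (cmeasurable_nat (fun k => v ^+ k) (measurableT_comp (measurable_obs n) msnd)).
Qed.

Lemma cmeasurable_damped_slice : cmeasurable (fun p : measurableTypeR R * T =>
  cexp (- theta * p.1%:C) * slice n u v wt x y p.1 p.2).
Proof.
apply: cmeasurableM; last exact: cmeasurable_slice.
exact: (cmeasurable_comp mfst cmeasurable_damping).
Qed.

(** The conditional expectation of the slice given the observation times. *)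
Let cond s w := (b w <= s < c w)%R%:R * (cexp (- theta * s%:C)
  * cexp (- wt * (b w)%:C - x * (gap tau n w)%:C)
  * (cexp ((lambda * b w)%:C * (g (u * v * y) - 1))
     * cexp ((lambda * (s - b w))%:C * (g (v * y) - 1))
     * cexp ((lambda * (c w - s))%:C * (g v - 1)))).

Let uvy1 : cmod (u * v * y) <= 1. Proof. by rewrite !cmodM_le1. Qed.

Let vy1 : cmod (v * y) <= 1. Proof. by rewrite !cmodM_le1. Qed.

Let Re_pgf_le0 (r : R) z : 0 <= r -> cmod z <= 1 -> Re ((lambda * r)%:C * (g z - 1)) <= 0.
Proof.
move=> r0 z1; rewrite cReMl mulr_ge0_le0 ?mulr_ge0 ?(ltW lambda_gt0)//.
rewrite cReD cReN subr_le0 (le_trans (ler_norm _))// (le_trans (cmod_Re _))//.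
exact: cmod_mark_pgf_le1.
Qed.

Let cmod_cond_le s w : cmod (cond s w) <= damping (Re theta) s.
Proof.
rewrite /cond; have [/andP[bs sc]|_] := boolP (b w <= s < c w); last first.
  by rewrite mul0r cmod0 damping_ge0.
have s0 : 0 <= s := le_trans (before_ge0 n w) bs.
rewrite mul1r -mulrA cmodM cmod_cexp_damping// ler_piMr ?damping_ge0//.
apply: cmodM_le1 => //; apply: cmodM_le1; first apply: cmodM_le1;
  apply: cmod_cexp_le1; apply: Re_pgf_le0 => //; rewrite ?subr_ge0 ?before_ge0//.
exact: ltW.
Qed.

Let mcond : cmeasurable (fun p : measurableTypeR R * T => cond p.1 p.2).
Proof.
have mB := measurableT_comp (mbefore n) msnd.
have mC := measurableT_comp (mtau n) msnd.
have mexp (r : measurableTypeR R * T -> R) z : measurable_fun setT r ->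
    cmeasurable (fun p => cexp ((lambda * r p)%:C * (g z - 1))).
  move=> mr; apply: cmeasurable_cexp; apply: cmeasurableM; last exact: cmeasurable_cst.
  by apply: cmeasurable_real; apply: measurable_funM => //; exact: measurable_cst.
apply: cmeasurableM; first exact: cmeasurable_bool.
apply: cmeasurableM; first apply: cmeasurableM.
- exact: (cmeasurable_comp mfst cmeasurable_damping).
- exact: (cmeasurable_comp msnd mdelay).
apply: cmeasurableM; first apply: cmeasurableM; apply: mexp => //; exact: measurable_funB.
Qed.

(** On the interval the three factors u^i v^j y^(A s) regroup into weights
    [u * v * y], [v * y] and [v] for the increments before the interval, from its
    start to [s], and from [s] to its end. Clamping the ends of the interval at
    [s] keeps the three times ordered outside of that event. *)
Lemma expectation_slice s :
  Cexpectation P (fun w => cexp (- theta * s%:C) * slice n u v wt x y s w) =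
  Cexpectation P (cond s).
Proof.
have [s0|s0] := ltP s 0.
  have out w : (b w <= s < c w) = false by rewrite lt_geF// (lt_le_trans s0) ?before_ge0.
  by apply: eq_cint => w; rewrite /slice /cond out !mulr0 mul0r.
pose S1 w := Num.min (b w) s; pose S3 w := Num.max (c w) s.
pose h w := (b w <= s < c w)%R%:R * (cexp (- theta * s%:C)
  * cexp (- wt * (b w)%:C - x * (gap tau n w)%:C)).
have mS1 : measurable_fun setT (S1 : Ttau -> R) by apply: measurable_minr => //; exact: measurable_cst.
have mS3 : measurable_fun setT (S3 : Ttau -> R) by apply: measurable_maxr => //; exact: measurable_cst.
have mh : cmeasurable (h : Ttau -> R[i]).
  apply: cmeasurableM.
    apply: cmeasurable_bool; apply: measurable_and.
      by apply: measurable_fun_ler => //; exact: measurable_cst.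
    by apply: measurable_fun_ltr => //; exact: measurable_cst.
  apply: cmeasurableM; first exact: cmeasurable_cst.
  apply: cmeasurable_cexp; apply: cmeasurableB; apply: cmeasurableM;
    try exact: cmeasurable_cst; apply: cmeasurable_real; [exact: mgen_before|exact: mgen_gap].
have h1 w : cmod (h w) <= 1.
  rewrite /h; case: (_ && _); rewrite ?mul0r ?cmod0 ?mul1r//; apply: cmodM_le1 => //.
  by apply: cmod_cexp_le1; rewrite cReMr cReN mulNr oppr_le0 mulr_ge0// ltW.
have S10 w : 0 <= S1 w by rewrite le_min before_ge0.
have S12 w : S1 w <= s by rewrite ge_min lexx orbT.
have S23 w : s <= S3 w by rewrite le_max lexx orbT.
have E := expectation_random_increments mt ma mtau lambda_gt0 poisson_t marking A_tau
  mS1 (measurable_cst s) mS3 mh S10 S12 S23 h1 uvy1 vy1 v1.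
transitivity (Cexpectation P (fun w =>
    h w * increments3 (fun r => A r w) (S1 w) s (S3 w) (u * v * y) (v * y) v)).
  apply: ae_eq_cint.
  - apply: (cmeasurable_comp (f := fun p : measurableTypeR R * T =>
      cexp (- theta * p.1%:C) * slice n u v wt x y p.1 p.2) (pair1_measurable s)).
    exact: cmeasurable_damped_slice.
  - have mid : measurable_fun setT (id : T -> Ttau).
      move=> _ B mB; rewrite setTI preimage_id.
      exact: (sigma_of_measurable (fun i (_ : setT i) => mtau i)).
    have mid' := @measurable_id _ T setT.
    have mB1 := mA_sampled (measurableT_comp mS1 mid) S10 mid'.
    have mB3 := mA_sampled (measurableT_comp mS3 mid) (fun w => le_trans s0 (S23 w)) mid'.
    apply: cmeasurableM; first exact: (cmeasurable_comp mid mh).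
    apply: cmeasurableM; first apply: cmeasurableM.
    + exact: (cmeasurable_nat (fun k => (u * v * y) ^+ k) mB1).
    + exact: (cmeasurable_nat (fun k => (v * y) ^+ k) (measurable_nat2 subn (mA s) mB1)).
    + exact: (cmeasurable_nat (fun k => v ^+ k) (measurable_nat2 subn mB3 (mA s))).
  apply: filterS (obs_before_ae n) => w Hw; rewrite /slice /h.
  have [/andP[bs sc]|_] := boolP (b w <= s < c w); last by rewrite !mulr0 !mul0r.
  rewrite /S1 /S3 (min_idPl bs) (max_idPl (ltW sc)) Hw /increments3.
  have Abs : (A (b w) w <= A s w)%N by exact: marked_sum_mono.
  have Asc : (A s w <= A (c w) w)%N by apply: marked_sum_mono => //; exact: ltW.
  rewrite /obs; move: (A (b w) w) (A s w) (A (c w) w) Abs Asc => p q r pq qr.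
  have [i qE] : exists i, q = (p + i)%N by exists (q - p)%N; rewrite subnKC.
  have [j rE] : exists j, r = (q + j)%N by exists (r - q)%N; rewrite subnKC.
  by rewrite rE addKn qE addKn !exprD !exprMn; ring.
rewrite E; apply: eq_cint => w; rewrite /h /cond.
have [/andP[bs sc]|_] := boolP (b w <= s < c w); last by rewrite !mul0r.
rewrite /S1 /S3 (min_idPl bs) (max_idPl (ltW sc)).
exact: (esym (mulrA _ _ _)).
Qed.

Let cexp5 (p q r s z : R[i]) :
  cexp p * cexp q * (cexp r * cexp s * cexp z) = cexp (p + q + (r + s + z)).
Proof. by rewrite (cexpD (p + q)) (cexpD p) (cexpD (r + s)) (cexpD r). Qed.

Let cexp_diff (e p q e' p' q' : R[i]) : e + p = e' + p' -> e + q = e' + q' ->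
  cexp e * (cexp p - cexp q) = cexp e' * (cexp p' - cexp q').
Proof. by move=> h1 h2; rewrite mulrBr [RHS]mulrBr -(cexpD e p) -(cexpD e q) h1 h2 !cexpD. Qed.

Hypothesis rho_neq0 : theta + lambda%:C * g v - lambda%:C * g (v * y) != 0.

Local Notation rho := (theta + lambda%:C * g v - lambda%:C * g (v * y)).

(** The exponent of [cond] is affine in [s] with slope - rho, so the integral is a
    difference of exponentials at the two ends, divided by rho. *)
Lemma cint_cond w : Cintegral mu setT (cond ^~ w) =
  gap_weight (u * v * y) (theta + wt) (b w) *
  (gap_weight v x (gap tau n w) - gap_weight (v * y) (theta + x) (gap tau n w)) / rho.
Proof.
pose e := - wt * (b w)%:C - x * (gap tau n w)%:C
  + (lambda * b w)%:C * (g (u * v * y) - 1) - (lambda * b w)%:C * (g (v * y) - 1)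
  + (lambda * c w)%:C * (g v - 1).
transitivity (Cintegral mu setT
    (fun s => (b w <= s < c w)%R%:R * (cexp e * cexp (- rho * s%:C)))).
  apply: eq_cint => s; rewrite /cond cexp5 -[in RHS]cexpD; congr (_ * _).
  apply: (f_equal cexp); rewrite /e !real_complexM !real_complexB.
  by move: (g _) (g _) (g _) => ? ? ?; ring.
rewrite cint_itv_cexp ?before_le//; apply: (f_equal (fun z => z / rho)).
have Eexp z th r : gap_weight z th r = cexp (- (th + lambda%:C * (1 - g z)) * r%:C) by [].
have gapE : (gap tau n w)%:C = (c w)%:C - (b w)%:C by rewrite -real_complexB.
rewrite !Eexp; apply: cexp_diff; rewrite /e gapE !real_complexM;
  by move: (g _) (g _) (g _) => ? ? ?; ring.
Qed.

(** Fubini in time, twice, around the conditional expectation; what remains is a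
    product of weights of distinct, hence independent, gaps. *)
Lemma slice_transform :
  Cintegral (mu \x P)%E setT (fun p => cexp (- theta * p.1%:C) * slice n u v wt x y p.1 p.2) =
  (\prod_(j < n) gamma_at P A tau j (u * v * y) (theta + wt)) *
  Gamma_ratio lambda g (gamma_at P A tau n) theta v x y.
Proof.
have dmp := integrable_damping theta0.
transitivity (Cintegral mu setT (fun s => Cexpectation P (cond s))).
  apply: etrans (cint_prod12 P cmeasurable_damped_slice dmp cmod_slice_le) _.
  by apply: eq_cint => s; exact: expectation_slice.
transitivity (Cintegral P setT (fun w => Cintegral mu setT (cond ^~ w))).
  apply: etrans (cint_prod21 P mcond dmp cmod_cond_le).
  exact: esym (cint_prod12 P mcond dmp cmod_cond_le).
rewrite (eq_cint _ cint_cond).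
have thwt0 : 0 <= Re (theta + wt) by rewrite cReD addr_ge0// ltW.
have thx0 : 0 <= Re (theta + x) by rewrite cReD addr_ge0// ltW.
have gap0 w : 0 <= gap tau n w by exact: (gaps_ge0 renewal).
have iW z z' th th' : cmod z <= 1 -> cmod z' <= 1 -> 0 <= Re th -> 0 <= Re th' ->
    cintegrable P (fun w => gap_weight z th (b w) * gap_weight z' th' (gap tau n w)).
  move=> z1 z1' t0 t0'; apply: (@cintegrable_bounded _ _ _ P _ 1) => [|w].
    by apply: cmeasurableM; apply: cmeasurable_gap_weight; [exact: mbefore|exact: mgap].
  by apply: cmodM_le1; apply: cmod_gap_weight_le1; rewrite ?before_ge0.
transitivity (Cintegral P setT (fun w => rho^-1 *
   (gap_weight (u * v * y) (theta + wt) (b w) * gap_weight v x (gap tau n w)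
    - gap_weight (u * v * y) (theta + wt) (b w) * gap_weight (v * y) (theta + x) (gap tau n w)))).
  by apply: eq_cint => w; rewrite mulrC mulrBr.
rewrite cintZ ?cintB//; [|exact: iW|exact: iW|by apply: cintegrableB; exact: iW].
have E1 := expectation_gap_weights n uvy1 thwt0 v1 x0.
have E2 := expectation_gap_weights n uvy1 thwt0 vy1 thx0.
apply: etrans (f_equal2 (fun p q => rho^-1 * (p - q)) E1 E2) _.
by rewrite -mulrBr /Gamma_ratio [LHS]mulrC -[LHS]mulrA.
Qed.

End slice.

(** ** Contraction of the gap transform *)

(** The modulus of the transform is at most the mean of exp (- Re theta gap), a
    variable with values in (0, 1]. That mean is 1 only if the gap vanishes almost
    surely, and then no factor of the transform differs from 1. *)
Lemma gap_transform_dichotomy (theta : R[i]) : 0 < Re theta ->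
  (forall z th, cmod z <= 1 -> 0 <= Re th -> gamma_at P A tau 1 z th = 1) \/
  (exists2 r : R, r < 1 & forall z th, cmod z <= 1 -> Re theta <= Re th ->
     cmod (gamma_at P A tau 1 z th) <= r).
Proof.
move=> theta0; have gap0 w : 0 <= gap tau 1 w by exact: (gaps_ge0 renewal).
pose f w := expR (- Re theta * gap tau 1 w).
have f1 w : f w <= 1.
  by rewrite -(expR0 R) ler_expR mulNr oppr_le0 mulr_ge0// ltW.
have mf : measurable_fun setT f.
  apply: (measurableT_comp (f := expR)); first exact: measurable_expR.
  by apply: measurable_funM => //; exact: measurable_cst.
have i1 := finite_measure_integrable_cst P (1 : R) measurableT.
have fi : P.-integrable setT (EFin \o f).
  apply: le_integrable i1 => //; first exact/measurable_EFinP.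
  by move=> w _ /=; rewrite lee_fin normr1 ger0_norm ?expR_ge0.
have I1 : \int[P]_w (1 : R) = 1.
  by rewrite Rintegral_cst// [X in fine X](probability_setT P) mulr1.
have [If|If] := ltP (\int[P]_w f w) 1.
  right; exists (\int[P]_w f w) => // z th z1 th0.
  have th0' : 0 <= Re th := le_trans (ltW theta0) th0.
  rewrite gamma_atE//; apply: cmod_cint_le => // [|w].
    apply: (@cintegrable_bounded _ _ _ P _ 1) => [|w]; last exact: cmod_gap_weight_le1.
    exact: cmeasurable_gap_weight.
  apply: le_trans (cmod_gap_weight_le z1 th0' (gap0 w)) _.
  by rewrite ler_expR ler_wpM2r// lerN2.
left=> z th z1 th0.
have i1f : P.-integrable setT (EFin \o (fun w => 1 - f w)).
  by apply: eq_integrable (integrableB _ i1 fi) => // w _ /=; rewrite EFinB.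
have I0 : \int[P]_w (1 - f w) = 0.
  apply: le_anti; rewrite Rintegral_ge0 ?andbT => [|w _]; last by rewrite subr_ge0.
  by rewrite RintegralB// I1 subr_le0.
have gap_ae : {ae P, forall w, gap tau 1 w = 0}.
  have : ae_eq P setT (EFin \o (fun w => 1 - f w)) (cst 0%E).
    apply/ae_eq_integral_abs => //; first by case/integrableP: i1f.
    rewrite -[RHS]/(0%:E) -I0 /Rintegral fineK; last exact: integrable_fin_num.
    by apply: eq_integral => w _ /=; rewrite ger0_norm// subr_ge0.
  apply: filterS => w /(_ I) /= [] /eqP; rewrite subr_eq0 eq_sym -(expR0 R).
  rewrite /f => /eqP /expR_inj /eqP; rewrite mulf_eq0 oppr_eq0 gt_eqF//= => /eqP.
  by [].
rewrite gamma_atE// -[RHS](Cexpectation_cst P); apply: ae_eq_cint.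
- exact: cmeasurable_gap_weight.
- exact: cmeasurable_cst.
by apply: filterS gap_ae => w ->; rewrite /gap_weight mulr0 cexp0.
Qed.

(** ** Summing over the observation intervals *)

Definition covers n (s : R) (w : T) : bool := before tau n w <= s < tau n w.

Lemma covers_unique n m s w : covers n s w -> covers m s w -> n = m.
Proof.
have lt_excl i j : (i < j)%N -> covers i s w -> covers j s w -> False.
  case: j => [//|j]; rewrite ltnS => /(tau_mono w) ij /andP[_ si] /andP[/= sj _].
  by move: (le_lt_trans (le_trans ij sj) si); rewrite ltxx.
by move=> cn cm; case: (ltngtP n m) => // h; [case: (lt_excl _ _ h cn cm)|case: (lt_excl _ _ h cm cn)].
Qed.

Lemma obs_before_le n w : (obs_before A tau n w <= obs A tau n w)%N.
Proof.
by case: n => [|n] //=; apply: marked_sum_mono => //; exact: (before_le n.+1).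
Qed.

Lemma obs_mono n m w : (n <= m)%N -> (obs A tau n w <= obs A tau m w)%N.
Proof. by move=> nm; apply: marked_sum_mono => //; exact: tau_mono. Qed.

Section functional.
Variables (u v wt x y theta : R[i]).
Hypotheses (u1 : cmod u <= 1) (v1 : cmod v <= 1) (y1 : cmod y <= 1).
Hypotheses (wt0 : 0 <= Re wt) (x0 : 0 <= Re x) (theta0 : 0 < Re theta).
Implicit Types q : nat -> nat -> R[i].

(** The functional with the levels of the process at the two ends of the
    interval that contains [s] entering through [q]. *)
Definition weighted q (s : R) (w : T) : R[i] :=
  if pselect (exists n, covers n s w) is left ex then
    let n := ex_minn ex in
    q (obs_before A tau n w) (obs A tau n w) * slice n u v wt x y s w
  else 0.

Lemma weighted_covers q n s w : covers n s w ->
  weighted q s w = q (obs_before A tau n w) (obs A tau n w) * slice n u v wt x y s w.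
Proof.
move=> cn; rewrite /weighted; case: pselect => [ex|[]]; last by exists n.
by case: ex_minnP => m cm _; rewrite (covers_unique cm cn).
Qed.

Lemma slice_out n u' v' s w : ~~ covers n s w -> slice n u' v' wt x y s w = 0.
Proof. by rewrite /slice /covers => /negbTE->; rewrite mulr0. Qed.

Lemma weighted_out q s w : ~ (exists n, covers n s w) -> weighted q s w = 0.
Proof. by rewrite /weighted; case: pselect. Qed.

(** A level crossed once stays crossed, so that the exit index is the only [n]
    whose interval starts below the level and ends above it. *)
Lemma exit_functionalE (crossed : pred nat) s w :
  ~~ crossed 0%N -> (forall i j, (i <= j)%N -> crossed i -> crossed j) ->
  exit_functional A tau crossed u v wt x y s w =
  weighted (fun i j => (~~ crossed i && crossed j)%:R) s w.
Proof.
move=> c0 cmono; rewrite /exit_functional /exit_index.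
case: pselect => [ex|nex] /=; last first.
  have [[m cm]|nm] := pselect (exists n, covers n s w); last by rewrite weighted_out.
  rewrite (weighted_covers _ cm) (_ : crossed (obs A tau m w) = false) ?andbF ?mul0r//.
  by apply/negP => h; apply: nex; exists m.
case: ex_minnP => n cn nmin; rewrite -/(slice n u v wt x y s w).
have ncb : ~~ crossed (obs_before A tau n w).
  case: (n) nmin => [|k] //= nmin; apply/negP => /nmin; by rewrite ltnn.
have [[m cm]|nm] := pselect (exists n, covers n s w); last first.
  by rewrite weighted_out// slice_out//; apply/negP => h; apply: nm; exists n.
rewrite (weighted_covers _ cm); have [nm|nm] := eqVneq n m.
  by rewrite -nm ncb cn mul1r.
rewrite slice_out; last by apply/negP => h; move: nm; rewrite (covers_unique h cm) eqxx.
case cmc : (crossed (obs A tau m w)); last by rewrite andbF mul0r.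
have nlem := nmin _ cmc.
case: m nm nlem {cm cmc} => [|m] nm nlem; first by move: nm; rewrite -leqn0 nlem.
have -> : crossed (obs_before A tau m.+1 w).
  rewrite /=; apply: cmono cn; apply: obs_mono; move: nlem.
  by rewrite leq_eqVlt (negbTE nm) ltnS.
by rewrite mul0r.
Qed.

Let damped q (p : measurableTypeR R * T) := cexp (- theta * p.1%:C) * weighted q p.1 p.2.

Let partial q m (p : measurableTypeR R * T) := \sum_(n < m)
  q (obs_before A tau n p.2) (obs A tau n p.2)
  * (cexp (- theta * p.1%:C) * slice n u v wt x y p.1 p.2).

Let partialE q m p : partial q m p = damped q p *
  (`[< exists2 n, (n < m)%N & covers n p.1 p.2 >])%:R.
Proof.
rewrite /partial /damped; case: asboolP => [[n nm cn]|nc]; last first.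
  rewrite mulr0 big1// => n _; rewrite slice_out ?mulr0//.
  by apply/negP => cn; apply: nc; exists n.
rewrite (bigD1 (Ordinal nm))//= big1 ?addr0 => [|i iN].
  by rewrite (weighted_covers _ cn) mulr1 mulrCA.
rewrite slice_out ?mulr0//; apply/negP => ci; move: iN.
by rewrite -val_eqE/= (covers_unique ci cn) eqxx.
Qed.

Let partial_cvg q p : exists N, forall m, (N <= m)%N -> partial q m p = damped q p.
Proof.
have [[n cn]|nc] := pselect (exists n, covers n p.1 p.2).
  exists n.+1 => m nm; rewrite partialE (_ : `[< _ >] = true) ?mulr1//.
  by apply/asboolP; exists n.
by exists 0%N => m _; rewrite partialE /damped (weighted_out _ nc) mulr0 mul0r.
Qed.

Let mpartial q m : cmeasurable (partial q m).
Proof.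
apply: cmeasurable_sum => n; apply: cmeasurableM; last exact: cmeasurable_damped_slice.
have msnd : measurable_fun setT (snd : measurableTypeR R * T -> T) by exact: measurable_snd.
split.
  apply: (measurable_nat2 (fun i j => Re (q i j))).
    exact: (measurableT_comp (measurable_obs_before n) msnd).
  exact: (measurableT_comp (measurable_obs n) msnd).
apply: (measurable_nat2 (fun i j => Im (q i j))).
  exact: (measurableT_comp (measurable_obs_before n) msnd).
exact: (measurableT_comp (measurable_obs n) msnd).
Qed.

Let mdamped q : cmeasurable (damped q).
Proof. exact: cmeasurable_eventually_constant (mpartial q) (partial_cvg q). Qed.

Let cmod_damped_le q k p : (forall i j, cmod (q i j) <= k) ->
  cmod (damped q p) <= k * damping (Re theta) p.1.
Proof.
move=> qk; have k0 : 0 <= k := le_trans (cmod_ge0 _) (qk 0%N 0%N).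
rewrite /damped; have [[n cn]|nc] := pselect (exists n, covers n p.1 p.2); last first.
  by rewrite (weighted_out _ nc) mulr0 cmod0 mulr_ge0 ?damping_ge0.
rewrite (weighted_covers _ cn) mulrCA cmodM ler_pM ?cmod_ge0//.
exact: cmod_slice_le.
Qed.

Let cmod_partial_le q k m p : (forall i j, cmod (q i j) <= k) ->
  cmod (partial q m p) <= k * damping (Re theta) p.1.
Proof.
move=> qk; rewrite partialE; case: asboolP => _; first by rewrite mulr1; exact: cmod_damped_le.
have k0 : 0 <= k := le_trans (cmod_ge0 _) (qk 0%N 0%N).
by rewrite mulr0 cmod0 mulr_ge0 ?damping_ge0.
Qed.

Let idamping k : mu.-integrable setT (EFin \o (fun s => k * damping (Re theta) s)).
Proof.
by apply: eq_integrable (integrableZl _ k (integrable_damping theta0)) => // s _ /=; rewrite EFinM.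
Qed.

Let bounded_weight q := exists k, forall i j, cmod (q i j) <= k.

Let idamped q : bounded_weight q -> cintegrable (mu \x P)%E (damped q).
Proof.
move=> [k qk]; apply: (cintegrable_prod P (mdamped q) (idamping k)) => s w.
exact: (cmod_damped_le (s, w)).
Qed.

(** The weight 1{i <= k < j} yields the functional of the exit interval, and
    z^i - z^j the generating function that the closed form expresses. *)
Definition total q : R[i] := Cintegral (mu \x P)%E setT (damped q).

Lemma total_linear q q1 q2 q3 h : (forall i j, q i j = q1 i j - q2 i j - h * q3 i j) ->
  bounded_weight q1 -> bounded_weight q2 -> bounded_weight q3 ->
  total q = total q1 - total q2 - h * total q3.
Proof.
move=> qE b1 b2 b3; rewrite /total -cintZ; last exact: idamped.
rewrite -cintB; [|exact: idamped|exact: idamped].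
rewrite -cintB; [|by apply: cintegrableB; exact: idamped|by apply: cintegrableZ; exact: idamped].
apply: eq_cint => p; rewrite /damped.
have [[n cn]|nc] := pselect (exists n, covers n p.1 p.2).
  by rewrite !(weighted_covers _ cn) qE; ring.
by rewrite !(weighted_out _ nc) !mulr0 !subr0.
Qed.

Lemma totalZ q c : bounded_weight q -> total (fun i j => c * q i j) = c * total q.
Proof.
move=> bq; rewrite /total -cintZ; last exact: idamped.
apply: eq_cint => p; rewrite /damped.
have [[n cn]|nc] := pselect (exists n, covers n p.1 p.2).
  by rewrite !(weighted_covers _ cn) -mulrA mulrCA.
by rewrite !(weighted_out _ nc) !mulr0.
Qed.

(** The process is nondecreasing, so the levels at the ends of an interval are
    ordered; the summation of runs, valid for i <= j, can thus be used in [total]. *)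
Lemma eq_total q q' : (forall i j, (i <= j)%N -> q i j = q' i j) -> total q = total q'.
Proof.
move=> qq'; apply: eq_cint => p; rewrite /damped.
have [[n cn]|nc] := pselect (exists n, covers n p.1 p.2).
  by rewrite !(weighted_covers _ cn) qq'// obs_before_le.
by rewrite !(weighted_out _ nc).
Qed.

Let mdamp k : measurable_fun setT (fun p : measurableTypeR R * T => k * damping (Re theta) p.1).
Proof.
apply: measurable_funM; first exact: measurable_cst.
apply: (measurableT_comp (f := damping (Re theta))); last exact: measurable_fst.
by apply: measurable_funM; [exact: measurable_cst|exact: measurable_exponential_pdf].
Qed.

Let damp_norm k s : 0 <= k -> `|k * damping (Re theta) s| <= k * damping (Re theta) s.
Proof. by move=> k0; rewrite ger0_norm// mulr_ge0// damping_ge0. Qed.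

Lemma cmod_total_le q k : (forall i j, cmod (q i j) <= k) ->
  cmod (total q) <= k * \int[mu]_s damping (Re theta) s.
Proof.
move=> qk; have k0 : 0 <= k := le_trans (cmod_ge0 _) (qk 0%N 0%N).
have bq : bounded_weight q by exists k.
have rh := fun (s : measurableTypeR R) (w : T) => damp_norm s k0.
apply: (le_trans (cmod_cint_le (idamped bq) (integrable_prod_dominated P (mdamp k) (idamping k) rh)
  (fun p => cmod_damped_le p qk))).
rewrite (Rintegral_prod12 P (mdamp k) (idamping k) rh).
rewrite -RintegralZl//; last exact: integrable_damping.
rewrite le_eqVlt; apply/orP; left; apply/eqP; apply: eq_Rintegral => s _ /=.
by rewrite Rintegral_cst// [X in fine X](probability_setT P) mulr1.
Qed.

Lemma total_cvg q : bounded_weight q ->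
  ccvg (fun m => Cintegral (mu \x P)%E setT (partial q m)) (total q).
Proof.
move=> [k qk]; have k0 : 0 <= k := le_trans (cmod_ge0 _) (qk 0%N 0%N).
have rh := fun (s : measurableTypeR R) (w : T) => damp_norm s k0.
apply: (cdominated_convergence (mpartial q) (mdamped q)
  (integrable_prod_dominated P (mdamp k) (idamping k) rh)) => [m p|p].
  exact: cmod_partial_le.
by have [N HN] := partial_cvg q p; exact: ccvg_eventually HN.
Qed.

(** ** The generating function of the levels *)

Section generating_function.
Variable z : R[i].
Hypothesis z1 : cmod z <= 1.
Hypothesis rho_v : theta + lambda%:C * g v - lambda%:C * g (v * y) != 0.
Hypothesis rho_vz : theta + lambda%:C * g (v * z) - lambda%:C * g (v * z * y) != 0.

Local Notation zeta := (u * v * y * z).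
Local Notation gam n := (gamma_at P A tau n).
Local Notation Gam n := (Gamma_of lambda g (gam n) theta v x y z).

(** The power z^i is absorbed by [u] and z^j by [v]; either way the increment
    before the interval gets the weight [u * v * y * z]. *)
Lemma partial_powers m :
  Cintegral (mu \x P)%E setT (partial (fun i j => z ^+ i - z ^+ j) m) =
  \sum_(n < m) (\prod_(j < n) gam j zeta (theta + wt)) * Gam n.
Proof.
have uz1 : cmod (u * z) <= 1 by exact: cmodM_le1.
have vz1 : cmod (v * z) <= 1 by exact: cmodM_le1.
pose f u' v' n (p : measurableTypeR R * T) :=
  cexp (- theta * p.1%:C) * slice n u' v' wt x y p.1 p.2.
have fi u' v' n : cmod u' <= 1 -> cmod v' <= 1 -> cintegrable (mu \x P)%E (f u' v' n).
  move=> u'1 v'1; apply: (cintegrable_prod P _ (integrable_damping theta0)).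
    exact: cmeasurable_damped_slice.
  by move=> s w; exact: cmod_slice_le.
transitivity (Cintegral (mu \x P)%E setT
    (fun p => \sum_(n < m) (f (u * z) v n p - f u (v * z) n p))).
  apply: eq_cint => p; apply: eq_bigr => n _.
  by rewrite /f /slice !exprMn; move: (cexp _) (cexp _) => e1 e2; ring.
rewrite cint_sum => [|n]; last by apply: cintegrableB; exact: fi.
apply: eq_bigr => n _; rewrite cintB; [|exact: fi|exact: fi].
rewrite (slice_transform n uz1 v1 y1 wt0 x0 theta0 rho_v).
rewrite (slice_transform n u1 vz1 y1 wt0 x0 theta0 rho_vz).
have -> : u * z * v * y = zeta by ring.
have -> : u * (v * z) * y = zeta by ring.
by rewrite -mulrBr.
Qed.

(** A geometric series in the transform of a gap. Where that transform is 1, the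
    intervals after the first one are empty and their factor vanishes, so that
    the value of the quotient in [B3] does not matter. *)
Lemma total_powers :
  total (fun i j => z ^+ i - z ^+ j) =
  Gam 0 + Gam 1 * B3 (gam 0) (gam 1) theta u v wt y z.
Proof.
have zeta1 : cmod zeta <= 1 by rewrite !cmodM_le1.
have vz1 : cmod (v * z) <= 1 by exact: cmodM_le1.
have thwt0 : 0 <= Re (theta + wt) by rewrite cReD addr_ge0// ltW.
have thx0 : 0 <= Re (theta + x) by rewrite cReD addr_ge0// ltW.
have bq : bounded_weight (fun i j => z ^+ i - z ^+ j).
  exists 2 => i j; rewrite (le_trans (cmodD _ _))// cmodN -[2]/(1 + 1).
  by apply: lerD; exact: cmodX_le1.
pose c0 := gam 0 zeta (theta + wt); pose c := gam 1 zeta (theta + wt).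
have GamS n : Gam n.+1 = Gam 1.
  by rewrite /Gamma_of /Gamma_ratio !(gamma_at_renewal n)// cmodM_le1.
have prodS n : \prod_(j < n.+1) gam j zeta (theta + wt) = c0 * c ^+ n.
  rewrite big_ord_recl/=; congr (_ * _).
  rewrite (eq_bigr (fun=> c)) ?prodr_const ?card_ord// => i _.
  exact: gamma_at_renewal.
have partialS m : Cintegral (mu \x P)%E setT (partial (fun i j => z ^+ i - z ^+ j) m.+1) =
    Gam 0 + Gam 1 * (c0 * \sum_(k < m) c ^+ k).
  rewrite partial_powers big_ord_recl big_ord0 mul1r; congr (_ + _).
  rewrite !mulr_sumr; apply: eq_bigr => k _.
  by rewrite -[lift ord0 k : nat]/(k.+1) GamS prodS mulrC.
have cS : ccvg (fun m => Gam 0 + Gam 1 * (c0 * \sum_(k < m) c ^+ k))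
    (total (fun i j => z ^+ i - z ^+ j)).
  exact: ccvg_ext partialS (ccvg_shift (total_cvg bq)).
apply: (ccvg_unique cS); rewrite /B3 -/c0 -/c.
have [deg|[r r1 cr]] := gap_transform_dichotomy theta0.
  have G1 : Gam 1 = 0.
    have vy1 : cmod (v * y) <= 1 by exact: cmodM_le1.
    have vzy1 : cmod (v * z * y) <= 1 by exact: cmodM_le1.
    have ratio0 r : cmod r <= 1 -> cmod (r * y) <= 1 ->
        Gamma_ratio lambda g (gam 1) theta r x y = 0.
      move=> r1 ry1; have E : gam 1 r x - gam 1 (r * y) (theta + x) = 0.
        by apply/eqP; rewrite subr_eq0; apply/eqP; exact: etrans (deg _ _ r1 x0) (esym (deg _ _ ry1 thx0)).
      apply: etrans (mul0r ((theta + lambda%:C * g r - lambda%:C * g (r * y))^-1)).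
      exact: (f_equal (fun p => p / _) E).
    by rewrite /Gamma_of (ratio0 v v1 vy1) (ratio0 (v * z) vz1 vzy1) subr0.
  rewrite G1 mul0r addr0; apply: (ccvg_ext (u := fun=> Gam 0)); last exact: ccvg_cst.
  by move=> m; rewrite mul0r addr0.
have cc : cmod c <= r by apply: cr => //; rewrite cReD lerDl.
have c1 : 1 - c != 0.
  rewrite subr_eq0; apply/eqP => c1; move: cc; rewrite -c1 cmod1 leNgt => /negP; exact.
have r0 : 0 <= r := le_trans (cmod_ge0 _) cc.
pose k := cmod (Gam 1) * (cmod c0 * cmod (1 - c)^-1).
have k0 : (fun m => k * r ^+ m) @ \oo --> 0.
  rewrite -[X in _ --> X](mulr0 k); apply: cvgMl_tmp; apply: cvg_expr.
  by rewrite ger0_norm.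
apply: (ccvg_squeeze _ k0) => m.
have -> : Gam 0 + Gam 1 * (c0 * \sum_(k < m) c ^+ k) - (Gam 0 + Gam 1 * (c0 / (1 - c)))
    = - (Gam 1 * (c0 * ((1 - c)^-1 * c ^+ m))).
  have -> : \sum_(k < m) c ^+ k = (1 - c ^+ m) / (1 - c).
    by apply: (mulIf c1); rewrite divfK// mulrC -[1 - c]opprB mulNr -subrX1 opprB.
  by move: (Gam 0) (Gam 1) (1 - c)^-1 (c ^+ m) => G0 G1 e1 e2; ring.
rewrite cmodN !cmodM cmodX /k -!mulrA.
do 3 (apply: ler_wpM2l; first exact: cmod_ge0).
by rewrite lerXn2r// nnegrE cmod_ge0.
Qed.

End generating_function.

(** ** Back to the exit interval *)

(** For a nondecreasing process the exit interval is the one that starts at a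
    level <= k and ends at a level > k. *)
Lemma G2star_total k : G2star P A tau (fun n => (k < n)%N) theta u v wt x y =
  total (fun i j => (i <= k < j)%N%:R).
Proof.
set q := fun i j => _; have bq : bounded_weight q.
  by exists 1 => i j; rewrite /q; case: (_ && _); rewrite ?cmod1 ?cmod0.
have q1 i j : cmod (q i j) <= 1 by rewrite /q; case: (_ && _); rewrite ?cmod1 ?cmod0.
have dq : forall s w, cmod (damped q (s, w)) <= 1 * damping (Re theta) s.
  by move=> s w; exact: (cmod_damped_le (s, w)).
rewrite /total (cint_prod12 P (mdamped q) (idamping 1) dq).
apply: cint_mkcond => s.
  rewrite /= in_itv/= andbT => s0.
  have ds : cintegrable P (fun w => damped q (s, w)).
    apply: (cintegrable_bounded P _ (dq s)).
    exact: (cmeasurable_comp (pair1_measurable (s : measurableTypeR R)) (mdamped q)).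
  have inv : cexp (- theta * s%:C) * cexp (theta * s%:C) = 1 by rewrite mulNr; exact: cexpN.
  have -> : Cexpectation P (exit_functional A tau (fun n => (k < n)%N) u v wt x y s) =
      Cintegral P setT (fun w => cexp (theta * s%:C) * damped q (s, w)).
    apply: eq_cint => w; rewrite exit_functionalE//; last by move=> i j ij ki; exact: leq_trans ki ij.
    rewrite /damped mulrA [_ * cexp (- theta * _)]mulrC inv mul1r.
    by rewrite /weighted; case: pselect => // ex; rewrite -leqNgt.
  by rewrite (cintZ _ ds) mulrA inv mul1r.
rewrite /= in_itv/= andbT => /negP; rewrite -ltNge => s0.
rewrite -[RHS](Cexpectation_cst P); apply: eq_cint => w.
rewrite /damped weighted_out ?mulr0// => -[n /andP[/= bs _]].
by move: (le_lt_trans (le_trans (before_ge0 n w) bs) s0); rewrite ltxx.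
Qed.

Lemma cmod_mark_pgf_sub0 z : cmod z <= 1 -> cmod (g z - g 0) <= cmod z.
Proof.
move=> z1; have mz r : cmeasurable (fun w => r ^+ a 0%N w).
  exact: (cmeasurable_nat (fun n => r ^+ n) (ma 0)).
have z01 : cmod (0 : R[i]) <= 1 by rewrite cmod0.
have iz r : cmod r <= 1 -> cintegrable P (fun w => r ^+ a 0%N w).
  by move=> r1; apply: (@cintegrable_bounded _ _ _ P _ 1) => // w; exact: cmodX_le1.
rewrite /mark_pgf /Cexpectation -cintB; [|exact: iz|exact: iz].
apply: cmod_Cexpectation_le => [|w]; first exact: cmeasurableB.
case: (a 0%N w) => [|n]; first by rewrite !expr0 subrr cmod0 cmod_ge0.
by rewrite [0 ^+ _]expr0n subr0 exprS cmodM ler_piMr ?cmod_ge0// cmodX_le1.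
Qed.

(** At [z = 0] the two generating functions cancel and [theta] is left; the
    pgf is 1-Lipschitz at 0. *)
Lemma rho_neq0_near0 z : 2 * lambda * cmod z < Re theta -> cmod z <= 1 ->
  theta + lambda%:C * g (v * z) - lambda%:C * g (v * z * y) != 0.
Proof.
move=> zt z1; apply/eqP => E.
have vz : cmod (v * z) <= cmod z by rewrite cmodM ler_piMl ?cmod_ge0.
have vzy : cmod (v * z * y) <= cmod z.
  by rewrite cmodM (le_trans _ vz)// ler_piMr ?cmod_ge0.
have thetaE : theta = lambda%:C * ((g (v * z * y) - g 0) - (g (v * z) - g 0)).
  have -> : theta = (theta + lambda%:C * g (v * z) - lambda%:C * g (v * z * y))
      + (lambda%:C * ((g (v * z * y) - g 0) - (g (v * z) - g 0))).
    by move: (g 0) (g (v * z)) (g (v * z * y)) => g0 g1 g2; ring.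
  by rewrite {1}E add0r.
have : cmod theta <= lambda * (cmod z + cmod z).
  rewrite thetaE cmodM cmodR gtr0_norm// ler_wpM2l ?(ltW lambda_gt0)//.
  rewrite (le_trans (cmodD _ _))// cmodN.
  apply: lerD; apply: le_trans (cmod_mark_pgf_sub0 _) _ => //; exact: le_trans z1.
rewrite leNgt => /negP; apply; apply: lt_le_trans (le_trans (ler_norm _) (cmod_Re theta)).
by apply: le_lt_trans zt; rewrite le_eqVlt; apply/orP; left; apply/eqP; ring.
Qed.

Let rhs z := Gamma_of lambda g (gamma_at P A tau 0) theta v x y z
  + Gamma_of lambda g (gamma_at P A tau 1) theta v x y z
    * B3 (gamma_at P A tau 0) (gamma_at P A tau 1) theta u v wt y z.

(** The generating function divided by [1 - z] is the total weight of the runs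
    z^i + .. + z^(j-1); its n-th derivative at 0 counts the runs through n. *)
Lemma Dop_total k :
  theta + lambda%:C * g v - lambda%:C * g (v * y) != 0 ->
  Dop (Posz k) rhs = total (fun i j => (i <= k < j)%N%:R).
Proof.
move=> rho_v.
pose rr : R := Num.min 16%:R^-1 (Re theta / (2 * lambda)).
have rr0 : 0 < rr.
  by rewrite lt_min invr_gt0 ltr0n divr_gt0// mulr_gt0.
have rr16 z : cmod z < rr -> `|z| < 16%:R^-1.
  have -> : 16%:R^-1 = (16%:R^-1)%:C :> R[i] by rewrite fmorphV rmorph_nat.
  by rewrite normcE_cmod ltcR lt_min => /andP[].
have rr1 z : cmod z < rr -> cmod z < 1.
  rewrite lt_min => /andP[z16 _]; apply: lt_trans z16 _.
  by rewrite invf_lt1 ?ltr1n ?ltr0n.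
have ltE z : (`|z| < rr%:C) = (cmod z < rr) by rewrite normcE_cmod ltcR.
pose F n z := total (fun i j => run_deriv n i j z).
have bR n z : cmod z < rr -> bounded_weight (fun i j => run_deriv n i j z).
  move=> /rr16 zr; exists (n`!%:R * 16%:R ^+ n * 2%:R) => i j.
  rewrite -le_cmodP; apply: le_trans (run_deriv_le n i j zr) _.
  by rewrite !real_complexM rmorphXn !rmorph_nat.
pose D := \int[mu]_s damping (Re theta) s.
have D0 : 0 <= D by apply: Rintegral_ge0 => s _; exact: damping_ge0.
pose K n : R := n`!%:R * 16%:R ^+ n * 2%:R * 16%:R ^+ 2 * D.
have K0 n : 0 <= (K n)%:C by rewrite ler0c !mulr_ge0// exprn_ge0.
rewrite (@Dop_taylor_family _ F (fun n => (K n)%:C) rr%:C) ?ltcR//.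
- rewrite /F -totalZ; last by apply: bR; rewrite cmod0.
  have k0 : k`!%:R != 0 :> R[i] by rewrite pnatr_eq0 -lt0n fact_gt0.
  by apply: eq_total => i j _; rewrite run_deriv_at0 mulKf.
- move=> n z h; rewrite !ltE => zr zhr.
  rewrite -(@total_linear (fun i j => run_deriv n i j (z + h) - run_deriv n i j z
    - h * run_deriv n.+1 i j z)) //; try exact: bR.
  have -> : (K n)%:C * `|h| ^+ 2 = (n`!%:R * 16%:R ^+ n * 2%:R * 16%:R ^+ 2 * cmod h ^+ 2 * D)%:C.
    by rewrite normcE_cmod -rmorphXn -real_complexM /K mulrAC.
  rewrite le_cmodP; apply: cmod_total_le => i j; rewrite -le_cmodP.
  apply: le_trans (run_deriv_taylor2 n i j (rr16 _ zr) (rr16 _ zhr)) _.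
  by rewrite normcE_cmod !real_complexM !rmorphXn !rmorph_nat.
- move=> z; rewrite ltE => zr; have z1 := ltW (rr1 _ zr).
  have nz1 : 1 - z != 0.
    by rewrite subr_eq0; apply/eqP => zE; move: (rr1 _ zr); rewrite -zE cmod1 ltxx.
  have rho_vz : theta + lambda%:C * g (v * z) - lambda%:C * g (v * z * y) != 0.
    apply: rho_neq0_near0 => //; move: zr; rewrite lt_min => /andP[_].
    by rewrite ltr_pdivlMr ?mulr_gt0// mulrC.
  apply: etrans (f_equal (fun c => (1 - z)^-1 * c) (esym (total_powers z1 rho_v rho_vz))) _.
  rewrite (@eq_total _ (fun i j => (1 - z) * run_deriv 0 i j z)) => [|i j ij]; last first.
    by rewrite run_deriv_telescope.
  by rewrite totalZ ?mulKf//; exact: bR.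
Qed.

End functional.

End observed.

Theorem theorem3p2 (R : realType) (d : measure_display) (T : measurableType d)
    (P : probability T R) (lambda : R) (points : nat -> {RV P >-> R})
    (marks : nat -> {RV P >-> nat}) (tau : nat -> {RV P >-> R})
    (M : nat) (theta u v wt x y : R[i]) :
  let A := marked_sum points marks in
  let g := mark_pgf P marks in
  let gamma0 := gamma_at P A tau 0 in
  let gamma := gamma_at P A tau 1 in
  let rhs := fun s : R[i] =>
    Gamma_of lambda g gamma0 theta v x y s
    + Gamma_of lambda g gamma theta v x y s * B3 gamma0 gamma theta u v wt y s in
  0 < lambda ->
  poisson_points P lambda points ->
  iid_marking P points marks ->
  delayed_renewal P tau ->
  independent_sigma P (sigma_of [set t : R | 0 <= t] A) (sigma_of setT tau) ->
  (0 < M)%N ->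
  `|u| <= 1 -> `|v| <= 1 -> `|y| <= 1 ->
  0 <= complex.Re wt -> 0 <= complex.Re x -> 0 < complex.Re theta ->
  theta + lambda%:C * g v - lambda%:C * g (v * y) != 0 ->
  G2star P A tau (fun n => M < n)%N theta u v wt x y = Dop M%:Z rhs
  /\ G2star P A tau (fun n => M <= n)%N theta u v wt x y = Dop (M%:Z - 1) rhs.
Proof.
move=> A g gamma0 gamma rhs lambda0 pts marking renewal A_tau M0 u1 v1 y1 wt0 x0 theta0 rho.
have le1 (z : R[i]) : `|z| <= 1 -> cmod z <= 1 by rewrite -le_cmodP.
have mpoints k : measurable_fun setT (points k) by exact: measurable_funP.
have mmarks k : measurable_fun setT (marks k) by exact: measurable_funP.
have mtau k : measurable_fun setT (tau k) by exact: measurable_funP.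
have key k : G2star P A tau (fun n => (k < n)%N) theta u v wt x y = Dop (Posz k) rhs.
  rewrite (G2star_total mpoints mmarks mtau pts renewal) ?le1//.
  by rewrite (Dop_total mpoints mmarks mtau lambda0 pts marking renewal A_tau) ?le1.
split; first exact: key.
case: M M0 => [//|M] _.
have -> : M.+1%:Z - 1 = Posz M by rewrite -addn1 PoszD addrK.
exact: key.
Qed.
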